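(* Let $\mathbf s=(\sigma_1,\dots,\sigma_p)$ be a reduced tuple of elements of $\mathcal S$ and let $w=\sigma_1\cdots\sigma_p$. Then for every $y\in WH_b$ with $y\le w$, \[ R^*_{y,w}=\sum_{\mathbf x\in\pi_{\mathbf s}^{-1}(y)}(\mathbf a\mathbf v^{-1})^{n(\mathbf x)}, \] where $\pi_{\mathbf s}\colon\mathcal D_{\mathbf s}\to WH_b$, $\pi_{\mathbf s}(x_0,\dots,x_p)=x_p$, is defined on the set $\mathcal D_{\mathbf s}$ of distinguished subexpressions of $\mathbf s$, and $n(\mathbf x)$ is the number of $j$ with $1\le j\le p$ and $x_{j-1}^{-1}x_j\in X_{\sigma_j}$.
   Context: Let $q$ be a prime power, $n\ge1$, and $a,b$ relatively prime positive integers with $ab=q-1$. Let $F_b$ be the subgroup of order $b$ of $\mathbb F_q^\times$, $H_b$ the group of diagonal matrices in $\mathrm{GL}_n(\mathbb F_q)$ with entries in $F_b$, and $W\subset\mathrm{GL}_n(\mathbb F_q)$ the group of permutation matrices, so $WH_b$ is a subgroup isomorphic to $G(b,1,n)$. $\mathcal S=\{s_1,\dots,s_{n-1}\}$, where $s_i$ is the permutation matrix of $(i,i+1)$; $\ell$ is the length function of $(W,\mathcal S)$, extended to $WH_b$ by $\ell(wd)=\ell(dw)=\ell(w)$ for $w\in W$, $d\in H_b$. For $\alpha\in F_b$, $h_i(\alpha)$ is the diagonal matrix with $i$-th diagonal entry $\alpha$ and other diagonal entries $1$; $h_{i,j}(\alpha)=h_i(\alpha)h_j((-1)^{b-1}\alpha^{-1})$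 for $i\ne j$; and $X_{s_i}=\{h_{i,i+1}(\alpha)\mid\alpha\in F_b\}$. Let $A=\mathbb Z[\mathbf a,\mathbf v]$ with $\mathbf a,\mathbf v$ indeterminates. $\mathcal H$ is the associative unital $A$-algebra with generators $\{t_s\mid s\in\mathcal S\}\cup\{t_d\mid d\in H_b\}$ and relations: $t_1=1_{\mathcal H}$; $t_dt_{d'}=t_{dd'}$; $t_dt_{s_i}=t_{s_i}t_{s_ids_i}$; $t_{s_i}t_{s_j}=t_{s_j}t_{s_i}$ if $|j-i|>1$; $t_{s_i}t_{s_{i+1}}t_{s_i}=t_{s_{i+1}}t_{s_i}t_{s_{i+1}}$; $t_{s_i}^2=\mathbf v^2 1_{\mathcal H}+\mathbf a\sum_{d\in X_{s_i}}t_dt_{s_i}$. For $x=wd$ with $w=s_{i_1}\cdots s_{i_p}\in W$ reduced and $d\in H_b$, $t_x=t_{s_{i_1}}\cdots t_{s_{i_p}}t_d$ (well defined); $\{t_x\}_{x\in WH_b}$ is an $A$-basis of $\mathcal H$. Let $A_{\mathbf v}=\mathbb Z[\mathbf a,\mathbf v,\mathbf v^{-1}]$, $\mathcal H_{\mathbf v}=A_{\mathbf v}\otimes_A\mathcal H$ and $T_x=\mathbf v^{-\ell(x)}\otimes t_x$, so $\{T_x\}_{x\in WH_b}$ is an $A_{\mathbf v}$-basis of $\mathcal H_{\mathbf v}$. Each $T_x$ is a unit. The bar involution: $\overline{\phantom{x}}\colon A_{\mathbf v}\to A_{\mathbf v}$ is the ring endomorphism with $\overline{\mathbf v}=\mathbf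 v^{-1}$, $\overline{\mathbf a}=-\mathbf a\mathbf v^{-2}$; it extends to $\mathcal H_{\mathbf v}$ by $\overline{\sum_x\gamma_xT_x}=\sum_x\overline{\gamma_x}\,\overline{T_x}$ with $\overline{T_x}=T_{x^{-1}}^{-1}$. Elements $R^*_{x,y}\in A_{\mathbf v}$ are defined by $\overline{T_y}=\sum_{x\in WH_b}\overline{R^*_{x,y}}\,T_x$, and $x\le y$ means $R^*_{x,y}\ne0$ (this is a partial order on $WH_b$). A tuple $(\sigma_1,\dots,\sigma_p)$ of elements of $\mathcal S$ is reduced if $\ell(\sigma_1\cdots\sigma_p)=p$. A distinguished subexpression of a reduced tuple $\mathbf s=(\sigma_1,\dots,\sigma_p)$ is a $(p+1)$-tuple $\mathbf x=(x_0,x_1,\dots,x_p)$ of elements of $WH_b$ such that $x_0=1$ and, for $1\le j\le p$, $x_{j-1}^{-1}x_j\in\{\sigma_j\}\cup X_{\sigma_j}$ and $x_j\le x_{j-1}\sigma_j$. *)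

(* Defs.v *)
From HB Require Import structures.
From mathcomp Require Import all_boot all_order all_fingroup all_algebra.
From mathcomp Require Import boolp.

Set Implicit Arguments.
Unset Strict Implicit.
Unset Printing Implicit Defensive.

Import GRing.Theory.
Local Open Scope ring_scope.

(** * The coefficient rings Z[a,v] and Z[a,v,1/v] *)

(* Z[a,v] is rendered as Z[a][v]. *)
Notation Arng := {poly {poly int}}.
Definition aA : Arng := ('X)%:P.
Definition vA : Arng := 'X.

Local Notation "x %:F" := (@tofrac _ x).

(* Z[a,v,1/v], as the subring of Frac(Z[a,v]) of the fractions p / v^k. *)
Definition laurent : {pred {fraction Arng}} :=
  fun x => `[< exists (p : Arng) (k : nat), x = p%:F / vA%:F ^+ k >].

Lemma vF_neq0 : vA%:F != 0 :> {fraction Arng}.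
Proof. by rewrite tofrac_eq0 polyX_eq0. Qed.

Lemma laurent_subring : subring_closed laurent.
Proof.
split.
- by apply/asboolP; exists 1, 0%N; rewrite expr0 divr1 tofrac1.
- move=> x y /asboolP[p [k ->]] /asboolP[r [l ->]]; apply/asboolP.
  exists (p * vA ^+ l - r * vA ^+ k), (k + l)%N.
  have vk m : vA%:F ^+ m != 0 :> {fraction Arng} by rewrite expf_neq0 ?vF_neq0.
  rewrite tofracB !tofracM !tofracXn exprD mulrBl invfM.
  congr (_ - _).
    by rewrite mulrACA divff // mulr1.
  by rewrite -mulrA (mulrA (vA%:F ^+ k)) divff // mul1r.
- move=> x y /asboolP[p [k ->]] /asboolP[r [l ->]]; apply/asboolP.
  by exists (p * r), (k + l)%N; rewrite tofracM exprD invfM mulrACA.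
Qed.

HB.instance Definition _ := GRing.isSubringClosed.Build _ laurent laurent_subring.

Record Av : Type := MkAv { Av_val : {fraction Arng}; Av_valP : Av_val \in laurent }.
HB.instance Definition _ := [isSub for Av_val].
HB.instance Definition _ := [Choice of Av by <:].
HB.instance Definition _ := [SubChoice_isSubComNzRing of Av by <:].

Lemma embA_subproof (p : Arng) : p%:F \in laurent.
Proof. by apply/asboolP; exists p, 0%N; rewrite expr0 divr1. Qed.

Definition embA (p : Arng) : Av := MkAv (embA_subproof p).

Lemma embA_is_zmod_morphism : zmod_morphism embA.
Proof. by move=> p r; apply/val_inj; exact: tofracB. Qed.
Lemma embA_is_monoid_morphism : monoid_morphism embA.
Proof.
split=> [|p r]; apply/val_inj; first exact: tofrac1.
exact: tofracM.
Qed.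
HB.instance Definition _ := GRing.isZmodMorphism.Build _ _ embA embA_is_zmod_morphism.
HB.instance Definition _ := GRing.isMonoidMorphism.Build _ _ embA embA_is_monoid_morphism.

Lemma vinv_subproof : vA%:F^-1 \in laurent.
Proof. by apply/asboolP; exists 1, 1%N; rewrite expr1 tofrac1 div1r. Qed.

Definition av : Av := embA aA.
Definition vv : Av := embA vA.
Definition vinv : Av := MkAv vinv_subproof.

Lemma vvK : vv * vinv = 1.
Proof. by apply/val_inj; rewrite rmorphM rmorph1 /= divff ?vF_neq0. Qed.

(** * The group W H_b *)

Section Group.
(* {'GL_n[F]} consists of matrices of size n.-1.+1, which is n as soon as 0 < n;
   's_1, ..., s_(n-1)' are indexed by 'I_n.-1. *)
Variables (F : finFieldType) (n b : nat) (Fb : {group {unit F}}).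
Implicit Types (x y d : {'GL_n[F]}) (i : 'I_n.-1) (u : seq 'I_n.-1).

Definition permGL (p : 'S_n.-1.+1) : {'GL_n[F]} :=
  FinRing.unit _ (unitmx_perm F p).

Definition Wset : {set {'GL_n[F]}} := [set x | is_perm_mx (GLval x)].

Definition Hb : {set {'GL_n[F]}} :=
  [set x | is_diag_mx (GLval x) &&
    [forall k, [exists alpha in Fb, GLval x k k == FinRing.uval alpha]]].

Definition WHb : {set {'GL_n[F]}} := (Wset * Hb)%g.

Definition idx0 i : 'I_n.-1.+1 := widen_ord (leqnSn _) i.
Definition idx1 i : 'I_n.-1.+1 := lift ord0 i.

Definition sgen i : {'GL_n[F]} := permGL (tperm (idx0 i) (idx1 i)).

Definition hrow (k : 'I_n.-1.+1) (alpha : {unit F}) : 'rV[F]_n.-1.+1 :=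
  \row_l (if l == k then FinRing.uval alpha else 1).

Lemma hdiag_subproof k alpha : diag_mx (hrow k alpha) \is a GRing.unit.
Proof.
rewrite [_ \is a _]unitmxE det_diag unitr_prod // => l _; rewrite mxE.
by case: eqP => _; [case: alpha | rewrite unitr1].
Qed.

Definition hdiag (k : 'I_n.-1.+1) (alpha : {unit F}) : {'GL_n[F]} :=
  FinRing.unit _ (hdiag_subproof k alpha).

Definition unitN1 : {unit F} := FinRing.unit F (unitrN1 F).

Definition hdiag2 (k l : 'I_n.-1.+1) (alpha : {unit F}) : {'GL_n[F]} :=
  (hdiag k alpha * hdiag l (unitN1 ^+ b.-1 * alpha^-1))%g.

Definition Xset i : {set {'GL_n[F]}} :=
  [set hdiag2 (idx0 i) (idx1 i) alpha | alpha in Fb].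

Definition word u : {'GL_n[F]} := (\prod_(i <- u) sgen i)%g.

Lemma permGLM (p r : 'S_n.-1.+1) : permGL (p * r)%g = (permGL p * permGL r)%g.
Proof. by apply/val_inj; rewrite /= perm_mxM. Qed.

Lemma tperm_gen (j : 'I_n.-1.+1) :
  tperm ord0 j \in <<[set tperm (idx0 i) (idx1 i) | i : 'I_n.-1]>>%g.
Proof.
case: j; elim=> [|j IHj] ltj.
  by rewrite (_ : Ordinal ltj = ord0) ?tperm1 ?group1 //; apply/val_inj.
have ltj' : (j < n.-1)%N by [].
have ltj2 : (j < n.-1.+1)%N by apply: leq_trans ltj' _.
pose i := Ordinal ltj'.
have mem_i : tperm (idx0 i) (idx1 i) \in
    <<[set tperm (idx0 i) (idx1 i) | i : 'I_n.-1]>>%g.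
  by apply: mem_gen; apply: imset_f.
have -> : Ordinal ltj = idx1 i by apply/val_inj.
have Ej : Ordinal ltj2 = idx0 i by apply/val_inj.
have {IHj} := IHj ltj2; rewrite Ej => IHj.
have [i0|i0] := eqVneq (idx0 i) ord0; first by rewrite -{1}i0.
suff -> : tperm ord0 (idx1 i) = (tperm ord0 (idx0 i) ^ tperm (idx0 i) (idx1 i))%g.
  by rewrite groupJ.
rewrite tpermJ tpermL tpermD //.
Qed.

Lemma word_perm (p : 'S_n.-1.+1) : exists u, permGL p = word u.
Proof.
have : p \in <<[set tperm (idx0 i) (idx1 i) | i : 'I_n.-1]>>%g.
  have sub : [set tperm ord0 j | j : 'I_n.-1.+1] \subset
      <<[set tperm (idx0 i) (idx1 i) | i : 'I_n.-1]>>%g.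
    by apply/subsetP => _ /imsetP[j _ ->]; apply: tperm_gen.
  have := gen_tperm (ord0 : 'I_n.-1.+1).
  move: sub; rewrite -gen_subG => /subsetP sub gT; apply: sub.
  by rewrite gT inE.
have M1 : permGL 1 = 1%g by apply/val_inj; rewrite /= perm_mx1.
move=> /gen_prodgP[k [c cS ->]].
elim: k c cS => [|k IHk] c cS.
  by exists [::]; rewrite big_ord0 /word big_nil.
rewrite big_ord_recl permGLM.
have [i _ ci] := imsetP (cS ord0).
have [u ->] := IHk (fun l => c (lift ord0 l)) (fun l => cS (lift ord0 l)).
by exists (i :: u); rewrite ci /word big_cons.
Qed.

Definition reach x (p : nat) : bool :=
  [exists u : p.-tuple 'I_n.-1, ((word u)^-1 * x)%g \in Hb].

Lemma ell_exists x : exists p, (x \in WHb) ==> reach x p.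
Proof.
case: (boolP (x \in WHb)) => [|_]; last by exists 0%N.
case/mulsgP => w d; rewrite inE => /is_perm_mxP[p wE] dH ->.
have [u uE] := word_perm p.
exists (size u); apply/existsP; exists (in_tuple u).
by rewrite -uE (_ : w = permGL p) ?mulKg //; apply/val_inj.
Qed.

(* The length of (W, S), extended by l(wd) = l(w): the least number of factors
   of a word s_(i_1) ... s_(i_p) in S with x in s_(i_1) ... s_(i_p) H_b.
   It takes the junk value 0 outside of W H_b. *)
Definition ell x : nat := ex_minn (ell_exists x).

Definition reduced u : bool := ell (word u) == size u.

End Group.

(** * The algebras H and H_v *)

(* The t_d are given as a function on all of GL_n(F), whose values outside of H_b
   are irrelevant; similarly below for the t_x, the T_x and the R*_{x,y},
   where only x, y in W H_b matter. *)
Record hecke_rels (F : finFieldType) (n b : nat) (Fb : {group {unit F}})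
    (H : algType Arng) (ts : 'I_n.-1 -> H) (td : {'GL_n[F]} -> H) : Prop :=
  HeckeRels {
    rel_one : td 1%g = 1;
    rel_mul : {in Hb n Fb &, forall d d', td d * td d' = td (d * d')%g};
    rel_comm : forall i, {in Hb n Fb, forall d,
      td d * ts i = ts i * td (sgen F i * d * sgen F i)%g};
    rel_far : forall i j : 'I_n.-1, (i.+1 < j)%N || (j.+1 < i)%N ->
      ts i * ts j = ts j * ts i;
    rel_braid : forall i j : 'I_n.-1, j = i.+1 :> nat ->
      ts i * ts j * ts i = ts j * ts i * ts j;
    rel_quad : forall i, ts i ^+ 2 =
      vA ^+ 2 *: 1 + aA *: (\sum_(d in Xset b Fb i) td d * ts i)
  }.

(* H is presented by the generators t_s (s in S), t_d (d in H_b) and the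
   relations [hecke_rels]. *)
Definition hecke_presented (F : finFieldType) (n b : nat) (Fb : {group {unit F}})
    (H : algType Arng) (ts : 'I_n.-1 -> H) (td : {'GL_n[F]} -> H) : Prop :=
  hecke_rels b Fb ts td /\
  forall (B : algType Arng) (us : 'I_n.-1 -> B) (ud : {'GL_n[F]} -> B),
    hecke_rels b Fb us ud ->
    let maps_gens (f : {lrmorphism H -> B}) :=
      (forall i, f (ts i) = us i) /\ {in Hb n Fb, forall d, f (td d) = ud d} in
    exists2 f : {lrmorphism H -> B}, maps_gens f &
      forall g : {lrmorphism H -> B}, maps_gens g -> g =1 f.

(* iota : h |-> 1 (x) h exhibits the S-algebra HS as the scalar extension
   S (x)_R H: it is the universal phi-semilinear map from H to an S-module, and
   being a ring morphism it determines the product of HS. *)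
Definition scalar_extension (R S : comNzRingType) (phi : {rmorphism R -> S})
    (H : algType R) (HS : algType S) (iota : {rmorphism H -> HS}) : Prop :=
  (forall r h, iota (r *: h) = phi r *: iota h) /\
  forall (M : lmodType S) (f : {additive H -> M}),
    (forall r h, f (r *: h) = phi r *: f h) ->
    exists2 g : {linear HS -> M}, (forall h, g (iota h) = f h) &
      forall g' : {linear HS -> M}, (forall h, g' (iota h) = f h) -> g' =1 g.

Definition standard_elts (F : finFieldType) (n : nat) (Fb : {group {unit F}})
    (H : algType Arng) (ts : 'I_n.-1 -> H) (td t : {'GL_n[F]} -> H) : Prop :=
  forall (u : seq 'I_n.-1) (d : {'GL_n[F]}), reduced Fb u -> d \in Hb n Fb ->
    t (word F u * d)%g = (\prod_(i <- u) ts i) * td d.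

Definition Telt (F : finFieldType) (n : nat) (Fb : {group {unit F}})
    (H : algType Arng) (Hv : algType Av) (iota : H -> Hv)
    (t : {'GL_n[F]} -> H) (x : {'GL_n[F]}) : Hv :=
  vinv ^+ ell Fb x *: iota (t x).

(** * The bar involution, R*, and distinguished subexpressions *)

Definition bar_scalar (bar : {rmorphism Av -> Av}) : Prop :=
  bar vv = vinv /\ bar av = - av * vinv ^+ 2.

Definition bar_extends (F : finFieldType) (n : nat) (Fb : {group {unit F}})
    (bar : Av -> Av) (Hv : unitAlgType Av) (T : {'GL_n[F]} -> Hv)
    (barH : Hv -> Hv) : Prop :=
  forall gamma : {'GL_n[F]} -> Av,
    barH (\sum_(x in WHb n Fb) gamma x *: T x) =
    \sum_(x in WHb n Fb) bar (gamma x) *: (T x^-1%g)^-1.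

Definition Rstar_def (F : finFieldType) (n : nat) (Fb : {group {unit F}})
    (bar : Av -> Av) (Hv : unitAlgType Av) (T : {'GL_n[F]} -> Hv)
    (barH : Hv -> Hv) (R : {'GL_n[F]} -> {'GL_n[F]} -> Av) : Prop :=
  {in WHb n Fb, forall y,
    barH (T y) = \sum_(x in WHb n Fb) bar (R x y) *: T x}.

Definition Rle (F : finFieldType) (n : nat)
    (R : {'GL_n[F]} -> {'GL_n[F]} -> Av) (x y : {'GL_n[F]}) : bool := R x y != 0.

Section Subexpressions.
Variables (F : finFieldType) (n b : nat) (Fb : {group {unit F}}).
Variable R : {'GL_n[F]} -> {'GL_n[F]} -> Av.
Variables (p : nat) (sigma : p.-tuple 'I_n.-1).
Implicit Types (j : 'I_p).

(* The j-th step goes from x_j to x_(j+1), with j counted from 0. *)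
Definition step (x : p.+1.-tuple {'GL_n[F]}) j : {'GL_n[F]} := ((nth 1 x j)^-1 * nth 1 x j.+1)%g.

Definition distinguished : {set p.+1.-tuple {'GL_n[F]}} :=
  [set x : p.+1.-tuple {'GL_n[F]} | [&& all (mem (WHb n Fb)) x, nth 1%g x 0 == 1%g &
    [forall j, (step x j \in sgen F (tnth sigma j) |: Xset b Fb (tnth sigma j))
       && Rle R (nth 1%g x j.+1) (nth 1%g x j * sgen F (tnth sigma j))%g]]].

Definition nX (x : p.+1.-tuple {'GL_n[F]}) : nat := #|[set j | step x j \in Xset b Fb (tnth sigma j)]|.

End Subexpressions.

(* Main.v *)
Require Import Defs.
From HB Require Import structures.
From mathcomp Require Import all_boot all_order all_fingroup all_algebra.
From mathcomp Require Import pgroup zify boolp.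

(* Write xi = a v^-1 and Theta_s = sum_(d in X_s) T_d. The quadratic relation
   gives T_s^-1 = T_s - xi Theta_s, so that bar T_(ys) = bar T_y (T_s - xi Theta_s)
   when l(ys) > l(y). Comparing coefficients in the basis (T_x), one gets
     R*_(z,ys) = R*_(zs,y) + [l(zs) > l(z)] xi sum_(d in X_s) R*_(z d^-1,y).
   By triangularity xd <= xs holds for d in X_s exactly when l(xs) > l(x), so
   this is also the recursion obtained by removing the last entry of a
   distinguished subexpression.

   The linear independence of the T_x is obtained from a representation on the
   free module with basis S_n x F^n: s_i acts by v P_i + a Theta_i D_i, where P_i
   permutes the basis and the diagonal operator D_i projects on the descents at i.
   A reduced word then sends the base vector to a power of v times a basis
   vector. *)

Set Implicit Arguments.
Unset Strict Implicit.
Unset Printing Implicit Defensive.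

Import GRing.Theory.
Local Open Scope ring_scope.

(** * Inversions *)

Section Inversions.
Variable n : nat.
Local Notation m := n.-1.+1.
Implicit Types (p r : 'S_m) (i : 'I_n.-1) (u : seq 'I_n.-1).

(** H is given only by generators and relations and H_v only by a universal property, so neither
    comes with a basis: comparing coefficients first requires a functional on H_v for each T_x. The
    matrices used for this are what right multiplication by t_s has to be in the would-be basis
    T_wd. As t_s = v T_s, one gets T_wd t_s = v T_wds plus, at a descent of w, the term a T_wd
    Theta_s. With T_x instead of t_x the factor v is the same at ascents and descents, so P_i is a
    plain permutation, and the entries stay in Z[a,v], over which H is presented. Diagonal parts are
    recorded in F^n, which contains F_b^n and on which the entries of a matrix in H_b act by
    multiplication. The laborious relation is the braid relation: it comes down to identities
    between the Theta's and between descent indicators for three positions. The second obstacle is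
    that the order is defined by the non-vanishing of R*, so the admissibility of a step has to be
    decided by computing values of R* itself. *)

Definition adj i : 'S_m := tperm (idx0 i) (idx1 i).

Definition ascent p i : bool := (p^-1 (idx0 i) < p^-1 (idx1 i))%N%g.

Definition invset p : {set 'I_m * 'I_m} :=
  [set kl : 'I_m * 'I_m | (kl.1 < kl.2)%N && (p^-1 kl.2 < p^-1 kl.1)%N%g].

Lemma in_invset p (k l : 'I_m) :
  ((k, l) \in invset p) = (k < l)%N && (p^-1 l < p^-1 k)%N%g.
Proof. by rewrite inE. Qed.

Definition ninv p : nat := #|invset p|.

Lemma idx0E i : idx0 i = i :> nat. Proof. by []. Qed.
Lemma idx1E i : idx1 i = i.+1 :> nat. Proof. by []. Qed.

Lemma idx01 i : idx0 i != idx1 i.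
Proof. by apply/eqP => /(congr1 (@nat_of_ord _)); rewrite idx0E idx1E; lia. Qed.

Lemma adjK i : (adj i * adj i = 1)%g.
Proof. exact: tperm2. Qed.

Lemma adjV i : ((adj i)^-1 = adj i)%g.
Proof. exact: tpermV. Qed.

Lemma adj_lt i (k l : 'I_m) :
  (k, l) != (idx0 i, idx1 i) -> (k < l)%N -> (adj i k < adj i l)%N.
Proof.
have eqN (j j' : 'I_m) : (j == j') = (j == j' :> nat) by [].
rewrite /adj xpair_eqE => neq lt_kl.
case: tpermP => [Ek|Ek|/eqP k0 /eqP k1]; case: tpermP => [El|El|/eqP l0 /eqP l1];
  subst; move: neq lt_kl; try (move: k0 k1); try (move: l0 l1);
  rewrite ?eqN ?idx0E ?idx1E; lia.
Qed.

(** Relabelling by [adj i] keeps every ordered pair in order except (i, i+1), so the inversions of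
    the product are the relabelled inversions of [p] together with that one new pair. *)
Lemma inv_asc p i : ascent p i -> ninv (p * adj i)%g = (ninv p).+1.
Proof.
move=> asc_i; pose f (kl : 'I_m * 'I_m) := (adj i kl.1, adj i kl.2).
have fK : involutive f by case=> k l; rewrite /f /= /adj !tpermK.
have E : invset (p * adj i)%g = (idx0 i, idx1 i) |: f @: invset p.
  apply/setP=> -[k l]; rewrite in_setU1 in_invset.
  rewrite -{2}[(k, l)]fK mem_imset; last exact: inv_inj.
  rewrite in_invset invMg adjV !permM.
  case: eqVneq => [[-> ->]|neq].
    by rewrite idx0E idx1E ltnSn /adj tpermL tpermR; move: asc_i; rewrite /ascent => ->.
  apply/andP/andP => -[lt_kl lt_p]; split=> //; first exact: adj_lt.
  have neq' : (adj i k, adj i l) != (idx0 i, idx1 i).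
    apply/eqP => -[Ek El]; move: lt_p; rewrite Ek El.
    by move: asc_i; rewrite /ascent; lia.
  by have := adj_lt neq' lt_kl; rewrite /adj !tpermK.
rewrite /ninv E cardsU1 card_imset; last exact: inv_inj.
suff -> : (idx0 i, idx1 i) \notin f @: invset p by [].
rewrite -[(idx0 i, idx1 i)]fK mem_imset; last exact: inv_inj.
by rewrite in_invset /adj tpermL tpermR idx0E idx1E ltnNge leqnSn.
Qed.

Lemma ascentM p i : ascent (p * adj i) i = ~~ ascent p i.
Proof.
rewrite /ascent invMg adjV !permM /adj tpermL tpermR -leqNgt ltn_neqAle.
by rewrite (inj_eq val_inj) (inj_eq perm_inj) eq_sym idx01.
Qed.

Lemma adj_far i (j : 'I_n.-1) : (i.+1 < j)%N || (j.+1 < i)%N ->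
  adj i (idx0 j) = idx0 j /\ adj i (idx1 j) = idx1 j.
Proof.
have neq (k l : 'I_m) : (k == l) = (k == l :> nat) by [].
by move=> h; rewrite /adj !tpermD // neq ?idx0E ?idx1E; lia.
Qed.

Lemma adj_comm i (j : 'I_n.-1) : (i.+1 < j)%N || (j.+1 < i)%N ->
  (adj i * adj j = adj j * adj i)%g.
Proof.
by move=> /adj_far[j0 j1]; apply/esym/commgP/conjg_fixP; rewrite tpermJ j0 j1.
Qed.

Lemma adj_braid i (j : 'I_n.-1) : j = i.+1 :> nat ->
  (adj i * adj j * adj i = adj j * adj i * adj j)%g.
Proof.
move=> ij; have Ej : idx0 j = idx1 i by apply: val_inj; rewrite /= ij.
have neq (x y : 'I_m) : (x == y) = (x == y :> nat) by [].
have kp : idx0 i != idx1 j by rewrite neq idx0E idx1E ij; lia.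
have lp : idx1 i != idx1 j by rewrite -Ej idx01.
(* Each side is a conjugate of a simple transposition, and both are the transposition of i and
   i+2. *)
rewrite -{1}(adjV i) -{2}(adjV j) -!mulgA -![(_^-1 * _)%g]/(_ ^ _)%g.
rewrite /adj !tpermJ Ej tpermR tpermL !tpermD // 1?eq_sym ?idx01 //.
Qed.

Lemma inv_desc p i : ~~ ascent p i -> ninv p = (ninv (p * adj i)%g).+1.
Proof.
by rewrite -ascentM => /inv_asc; rewrite -mulgA adjK mulg1.
Qed.

Definition pword u : 'S_m := (\prod_(i <- u) adj i)%g.

Lemma pword_rcons u i : pword (rcons u i) = (pword u * adj i)%g.
Proof. by rewrite /pword -cats1 big_cat big_seq1. Qed.

Lemma pword_rev u : pword (rev u) = (pword u)^-1%g.
Proof.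
elim: u => [|i u IHu]; first by rewrite /pword !big_nil invg1.
by rewrite rev_cons pword_rcons IHu /pword big_cons invMg adjV.
Qed.

Lemma ninv1 : ninv 1%g = 0%N.
Proof.
apply/eqP; rewrite cards_eq0; apply/eqP/setP=> -[k l].
by rewrite !inE /= invg1 !perm1; lia.
Qed.

Lemma inv_pword u : (ninv (pword u) <= size u)%N.
Proof.
elim/last_ind: u => [|u i IHu]; first by rewrite /pword big_nil ninv1.
rewrite pword_rcons size_rcons; case: (boolP (ascent (pword u) i)) => h.
  by rewrite inv_asc.
by move: (inv_desc h) IHu; lia.
Qed.

(** The inverse [r] of [p] is then strictly increasing, so r k >= k for all k; since [r] permutes
    the indices, the sums of both sides agree and no inequality is strict. *)
Lemma all_ascent p : (forall i, ascent p i) -> p = 1%g.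
Proof.
move=> asc; apply: invg_inj; rewrite invg1; set r := (p^-1)%g.
have ge k (kn : (k < m)%N) : (k <= r (Ordinal kn))%N.
  elim: k kn => // k IHk kn.
  have kn' : (k < n.-1)%N by [].
  have := asc (Ordinal kn'); rewrite /ascent -/r.
  have -> : idx1 (Ordinal kn') = Ordinal kn by apply: val_inj.
  by apply: leq_ltn_trans; apply: leq_trans (IHk (ltnW kn)) _;
    rewrite (_ : idx0 _ = Ordinal (ltnW kn)) //; apply: val_inj.
have sum_eq : (\sum_(k < m) r k = \sum_(k < m) k)%N.
  by rewrite [RHS](reindex_inj (@perm_inj _ r)).
apply/permP=> k; rewrite perm1; apply: val_inj; apply/eqP; rewrite eqn_leq.
have geo (l : 'I_m) : (l <= r l)%N by case: l => l ll; apply: ge.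
rewrite geo andbT leqNgt; apply/negP => lt.
move: sum_eq; rewrite (bigD1 k) //= [RHS](bigD1 k) //=.
have : (\sum_(i < m | i != k) i <= \sum_(i < m | i != k) r i)%N by apply: leq_sum.
by move=> le eq; have := leq_add lt le; rewrite addSn eq ltnn.
Qed.

Lemma pword_inv p : exists2 u, p = pword u & size u = ninv p.
Proof.
have [k] := ubnP (ninv p); elim: k p => // k IHk p.
case: (boolP [forall i, ascent p i]) => [/forallP/all_ascent -> _|].
  by exists [::]; rewrite ?ninv1 // /pword big_nil.
rewrite negb_forall => /existsP[i /inv_desc E]; rewrite E ltnS => /IHk[u Eu su].
by exists (rcons u i); rewrite ?size_rcons ?su // pword_rcons -Eu -mulgA adjK mulg1.
Qed.

End Inversions.

(** * Monomial matrices *)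

Section Monomial.
Variables (F : finFieldType) (n : nat).
Local Notation m := n.-1.+1.
Local Notation GL := {'GL_n[F]}.
Implicit Types (p r : 'S_m) (i : 'I_n.-1) (u : seq 'I_n.-1) (c : 'I_m -> {unit F}).

Lemma dgl_subproof c : diag_mx (\row_l FinRing.uval (c l)) \is a GRing.unit.
Proof.
by rewrite [_ \is a _]unitmxE det_diag unitr_prod // => l _; rewrite mxE; case: (c l).
Qed.

Definition dgl c : GL := FinRing.unit _ (dgl_subproof c).

Lemma dglE c k l : GLval (dgl c) k l = FinRing.uval (c k) *+ (k == l).
Proof. by rewrite /= !mxE; case: eqP => [->|]. Qed.

Lemma permGL_dglE p c k l :
  GLval (permGL F p * dgl c)%g k l = FinRing.uval (c (p k)) *+ (p k == l).
Proof. by rewrite GL_MxE (_ : GLval (permGL F p) = perm_mx p) // -row_permE mxE dglE. Qed.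

Lemma eq_dgl c c' : c =1 c' -> dgl c = dgl c'.
Proof. by move=> E; apply: val_inj; apply/matrixP=> k l; rewrite [LHS]dglE [RHS]dglE E. Qed.

Lemma permGL1 : permGL F (1%g : 'S_m) = 1%g.
Proof. by apply/val_inj; rewrite /= perm_mx1. Qed.

Lemma permGLV p : ((permGL F p)^-1 = permGL F p^-1)%g.
Proof. by apply: invg_inj; rewrite invgK; apply: (mulgI (permGL F p^-1)%g); rewrite mulgV -permGLM mulVg permGL1. Qed.

Lemma word_pword u : word F u = permGL F (pword u).
Proof.
elim: u => [|i u IHu]; first by rewrite /word /pword !big_nil permGL1.
by rewrite /word /pword !big_cons permGLM -/(pword u) -IHu.
Qed.

Lemma dgl1 : dgl (fun=> 1%g) = 1%g.
Proof.
by apply: val_inj; apply/matrixP=> k l; rewrite [LHS]dglE /= mxE.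
Qed.

Lemma dglM c c' : (dgl c * dgl c')%g = dgl (fun k => c k * c' k)%g.
Proof.
apply: val_inj; apply: etrans (mulmx_diag _ _) _; congr diag_mx.
by apply/rowP=> k; rewrite !mxE.
Qed.

Lemma dglV c : ((dgl c)^-1)%g = dgl (fun k => (c k)^-1)%g.
Proof.
apply: (mulgI (dgl c)); rewrite mulgV dglM -dgl1.
by apply: eq_dgl => k; rewrite mulgV.
Qed.

Lemma dgl_permGL c p : (dgl c * permGL F p = permGL F p * dgl (c \o (p^-1)%g))%g.
Proof.
apply: val_inj; apply: etrans (mul_diag_mx _ _) _; apply/matrixP=> k l.
rewrite [RHS]permGL_dglE /= permK !mxE.
by case: eqP => _; rewrite ?mulr1 ?mulr0.
Qed.

(** The nonzero entries sit at the positions (k, p k), which recovers [p]; their values then recover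
    [c]. *)
Lemma permGL_dgl_inj p p' c c' :
  (permGL F p * dgl c = permGL F p' * dgl c')%g -> p = p' /\ c =1 c'.
Proof.
move=> E; have Ep : p = p'.
  apply/permP=> k; apply/eqP; apply: contraT => neq.
  move/(congr1 (fun x => GLval x k (p k)))/eqP: E.
  rewrite !permGL_dglE eqxx (eq_sym (p' k)) (negbTE neq) mulr1n mulr0n.
  by case: (c (p k)) => x /= ux /eqP x0; rewrite x0 unitr0 in ux.
split=> // k; subst p'; apply: val_inj.
move/(congr1 (fun x => GLval x (p^-1 k)%g k)): E.
by rewrite !permGL_dglE permKV eqxx !mulr1n.
Qed.

Lemma sgenE i : sgen F i = permGL F (adj i). Proof. by []. Qed.

Lemma sgenK i : (sgen F i * sgen F i = 1)%g.
Proof. by rewrite !sgenE -permGLM adjK permGL1. Qed.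

Lemma sgenV i : ((sgen F i)^-1 = sgen F i)%g.
Proof. by apply: (mulgI (sgen F i)); rewrite mulgV sgenK. Qed.

End Monomial.

(** * The group W H_b, its length function and the sets X_s *)

Section Group.
Variables (F : finFieldType) (n b : nat) (Fb : {group {unit F}}).
Local Notation m := n.-1.+1.
Local Notation GL := {'GL_n[F]}.
Implicit Types (p r : 'S_m) (i : 'I_n.-1) (u : seq 'I_n.-1) (c : 'I_m -> {unit F}).
Implicit Types (x y d : GL).
Local Notation Hb := (Hb n Fb).
Local Notation WHb := (WHb n Fb).
Local Notation ell := (ell Fb).

Lemma HbP d : reflect (exists2 c, forall k, c k \in Fb & d = dgl c) (d \in Hb).
Proof.
apply: (iffP idP) => [|[c cF ->]].
  rewrite inE => /andP[/is_diag_mxP dD /forallP h].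
  have h' k : exists alpha, (alpha \in Fb) && (GLval d k k == FinRing.uval alpha).
    by have /existsP := h k.
  exists (fun k => xchoose (h' k)) => [k|]; first by have /andP[] := xchooseP (h' k).
  apply: val_inj; apply/matrixP=> k l; rewrite [RHS]dglE.
  case: eqVneq => [<-|neq]; last by rewrite [LHS]dD.
  by have /andP[_ /eqP] := xchooseP (h' k).
rewrite inE; apply/andP; split.
  by apply/is_diag_mxP => k l kl; rewrite dglE (_ : (k == l) = false) //; apply: negbTE; apply: contraNneq kl => ->.
apply/forallP=> k; apply/existsP; exists (c k).
by rewrite cF dglE eqxx /=.
Qed.

Lemma Hb1 : 1%g \in Hb.
Proof. by apply/HbP; exists (fun=> 1%g); rewrite ?dgl1. Qed.

Lemma HbM : {in Hb &, forall d d', (d * d')%g \in Hb}.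
Proof.
move=> _ _ /HbP[c cF ->] /HbP[c' cF' ->]; apply/HbP.
by exists (fun k => c k * c' k)%g => [k|]; rewrite ?dglM // groupM.
Qed.

Lemma HbV : {in Hb, forall d, (d^-1)%g \in Hb}.
Proof.
move=> _ /HbP[c cF ->]; apply/HbP.
by exists (fun k => (c k)^-1)%g => [k|]; rewrite ?dglV // groupV.
Qed.

Lemma HbJ p : {in Hb, forall d, (permGL F p^-1 * d * permGL F p)%g \in Hb}.
Proof.
move=> _ /HbP[c cF ->]; apply/HbP.
exists (c \o (p^-1)%g) => [k|]; first exact: cF.
by rewrite -mulgA dgl_permGL mulgA -permGLM mulVg permGL1 mul1g.
Qed.

Lemma HbJs i : {in Hb, forall d, (sgen F i * d * sgen F i)%g \in Hb}.
Proof. by move=> d dH; have := HbJ (adj i) dH; rewrite adjV. Qed.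

Lemma WHbP x : reflect (exists p, exists2 d, d \in Hb & x = (permGL F p * d)%g) (x \in WHb).
Proof.
apply: (iffP mulsgP) => [[w d]|[p [d dH ->]]].
  rewrite inE => /is_perm_mxP[p wE] dH ->; exists p, d => //.
  by congr (_ * _)%g; apply: val_inj.
by exists (permGL F p) d => //; rewrite inE; apply/is_perm_mxP; exists p.
Qed.

Lemma permGL_WHb p : permGL F p \in WHb.
Proof. by apply/WHbP; exists p, 1%g; rewrite ?mulg1 ?Hb1. Qed.

Lemma WHb1 : 1%g \in WHb.
Proof. by rewrite -(permGL1 F n) permGL_WHb. Qed.

Lemma Hb_WHb : {subset Hb <= WHb}.
Proof. by move=> d dH; apply/WHbP; exists 1%g, d; rewrite ?permGL1 ?mul1g. Qed.

Lemma WHbM : {in WHb &, forall x y, (x * y)%g \in WHb}.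
Proof.
move=> _ _ /WHbP[p [d dH ->]] /WHbP[r [d' dH' ->]]; apply/WHbP.
exists (p * r)%g, (permGL F r^-1 * d * permGL F r * d')%g; first by rewrite HbM // HbJ.
by rewrite permGLM -!mulgA; congr (_ * _)%g; rewrite !mulgA -permGLM mulgV permGL1 mul1g.
Qed.

Lemma WHbV : {in WHb, forall x, (x^-1)%g \in WHb}.
Proof.
move=> _ /WHbP[p [d dH ->]]; rewrite invMg permGLV.
by rewrite WHbM ?permGL_WHb // Hb_WHb // HbV.
Qed.

Lemma sgen_WHb i : sgen F i \in WHb. Proof. exact: permGL_WHb. Qed.

Lemma WHbMs i x : ((x * sgen F i)%g \in WHb) = (x \in WHb).
Proof.
apply/idP/idP => h; last by rewrite WHbM ?sgen_WHb.
by rewrite -(mulgK (sgen F i) x) WHbM // WHbV // sgen_WHb.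
Qed.

Lemma WHbMd d x : d \in Hb -> ((x * d)%g \in WHb) = (x \in WHb).
Proof.
move=> dH; apply/idP/idP => h; last by rewrite WHbM // Hb_WHb.
by rewrite -(mulgK d x) WHbM // WHbV // Hb_WHb.
Qed.

Lemma permGL_Hb p : permGL F p \in Hb -> p = 1%g.
Proof.
move/HbP => [c _ E].
have : (permGL F p * dgl (fun=> 1) = permGL F 1 * dgl c)%g.
  by rewrite dgl1 mulg1 permGL1 mul1g.
by case/permGL_dgl_inj.
Qed.

Lemma reachE p d k : d \in Hb ->
  reach Fb (permGL F p * d)%g k = [exists u : k.-tuple 'I_n.-1, pword u == p].
Proof.
move=> dH; apply: eq_existsb => u; rewrite word_pword permGLV mulgA -permGLM.
apply/idP/eqP => [h|->]; last by rewrite mulVg permGL1 mul1g.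
have /permGL_Hb : permGL F ((pword u)^-1 * p)%g \in Hb.
  by rewrite -(mulgK d (permGL F _)) HbM // HbV.
by move/(congr1 (mulg (pword u))); rewrite mulKVg mulg1.
Qed.

(** Trades the minimal word length for an inversion count, on which the effect of a simple
    reflection can be read off. *)
Lemma ell_inv p d : d \in Hb -> ell (permGL F p * d)%g = ninv p.
Proof.
move=> dH; have W : (permGL F p * d)%g \in WHb by apply/WHbP; exists p, d.
rewrite /ell; case: ex_minnP => k; rewrite W /= => rk mink.
apply/eqP; rewrite eqn_leq mink.
  move: rk; rewrite reachE // => /existsP[u /eqP <-].
  by apply: leq_trans (inv_pword _) _; rewrite size_tuple.
rewrite reachE //; apply/existsP; have [u Eu su] := pword_inv p.
by have us : size u == ninv p by [rewrite su]; exists (Tuple us); rewrite /= -Eu.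
Qed.

Lemma ell_permGL p : ell (permGL F p) = ninv p.
Proof. by rewrite -[permGL F p]mulg1 ell_inv ?Hb1. Qed.

Lemma ell_mulHb x d : x \in WHb -> d \in Hb -> ell (x * d)%g = ell x.
Proof.
by case/WHbP=> p [d' d'H ->] dH; rewrite -mulgA !ell_inv // HbM.
Qed.

Lemma mul_permGL_sgen p d i :
  (permGL F p * d * sgen F i = permGL F (p * adj i) * (sgen F i * d * sgen F i))%g.
Proof. by rewrite permGLM -sgenE -!mulgA (mulgA (sgen F i)) sgenK mul1g. Qed.

Lemma ell_sgen i x : x \in WHb ->
  ell (x * sgen F i)%g = (ell x).+1 \/ ell x = (ell (x * sgen F i)%g).+1.
Proof.
case/WHbP=> p [d dH ->]; rewrite mul_permGL_sgen !ell_inv ?HbJs //.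
by case: (boolP (ascent p i)) => [/inv_asc|/inv_desc] ->; [left | right].
Qed.

Lemma ell_eq0 x : x \in WHb -> ell x = 0%N -> x \in Hb.
Proof.
case/WHbP=> p [d dH ->]; rewrite ell_inv //.
have [[|j u] -> <-] := pword_inv p => // _.
by rewrite /pword big_nil permGL1 mul1g.
Qed.

Lemma exists_descent x : x \in WHb -> (0 < ell x)%N ->
  exists i, ell x = (ell (x * sgen F i)%g).+1.
Proof.
case/WHbP=> p [d dH ->]; rewrite ell_inv // => p0.
have [/forallP asc|] := boolP [forall i, ascent p i].
  by rewrite (all_ascent asc) ninv1 in p0.
rewrite negb_forall => /existsP[i Hi]; exists i.
by rewrite mul_permGL_sgen ell_inv ?HbJs // -inv_desc.
Qed.

Lemma reduced_ninv u : reduced Fb u = (ninv (pword u) == size u).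
Proof. by rewrite /reduced word_pword ell_permGL. Qed.

Lemma word_rcons u i : word F (rcons u i) = (word F u * sgen F i)%g.
Proof. by rewrite /word -cats1 big_cat big_seq1. Qed.

Lemma word_WHb u : word F u \in WHb.
Proof. by rewrite word_pword permGL_WHb. Qed.

Lemma reduced_rcons u i : reduced Fb (rcons u i) ->
  reduced Fb u /\ ell (word F u * sgen F i)%g = (ell (word F u)).+1.
Proof.
rewrite /reduced word_rcons size_rcons => /eqP E.
have le : (ell (word F u) <= size u)%N by rewrite word_pword ell_permGL inv_pword.
by have [] := ell_sgen i (word_WHb u) => h; (split; [apply/eqP|]); lia.
Qed.

Lemma reduced_word x : x \in WHb ->
  exists u, exists2 d, d \in Hb & reduced Fb u /\ x = (word F u * d)%g.
Proof.
case/WHbP=> p [d dH ->]; have [u Eu su] := pword_inv p.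
by exists u, d => //; rewrite reduced_ninv word_pword -Eu su eqxx.
Qed.

Lemma reduced_rev u : reduced Fb u -> reduced Fb (rev u).
Proof.
rewrite !reduced_ninv => /eqP ru; rewrite eqn_leq inv_pword size_rev -ru pword_rev.
have [v Ev <-] := pword_inv (pword u)^-1.
by rewrite -[pword u]invgK Ev -pword_rev -size_rev inv_pword.
Qed.

Lemma word_rev u : word F (rev u) = (word F u)^-1%g.
Proof. by rewrite !word_pword pword_rev permGLV. Qed.

(* -1 is the only element of order 2 of the units of F, so it lies in Fb when
   the order b of Fb is even, and (-1)^(b-1) = 1 when b is odd. *)
Lemma sign_Fb : #|Fb| = b -> (unitN1 F ^+ b.-1)%g \in Fb.
Proof.
move=> cFb; have b0 : (0 < b)%N by rewrite -cFb cardG_gt0.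
have N1K : (unitN1 F ^+ 2 = 1)%g by apply: val_inj; rewrite /= mulrNN mulr1.
have [ob|eb] := boolP (odd b).
  have : ~~ odd b.-1 by case: (b) b0 ob => //= b' _ /negbTE ->.
  by move=> /even_halfK <-; rewrite -mul2n expgM N1K expg1n group1.
have /(@Cauchy _ 2 _ isT)[x xF ox] : (2 %| #|Fb|)%N by rewrite cFb dvdn2.
suff <- : x = unitN1 F by rewrite groupX.
have x2 : FinRing.uval x ^+ 2 = 1.
  by have := expg_order x; rewrite ox => /(congr1 (@FinRing.uval _)).
apply: val_inj; move/eqP: x2; rewrite sqrf_eq1 => /orP[/eqP x1|/eqP //].
by have := order1 {unit F}; rewrite -(_ : x = 1%g) ?ox //; apply: val_inj.
Qed.

(** The diagonal of h_{k,l}(alpha) as a function of the position, which makes conjugation by a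
    permutation a precomposition. *)
Definition hvec (k l : 'I_m) (alpha : {unit F}) (j : 'I_m) : {unit F} :=
  ((if j == k then alpha else 1) * (if j == l then unitN1 F ^+ b.-1 * alpha^-1 else 1))%g.

Lemma hdiag2E k l alpha : hdiag2 b k l alpha = dgl (hvec k l alpha).
Proof.
rewrite /hdiag2 (_ : hdiag k alpha = dgl (fun j => if j == k then alpha else 1%g)).
  rewrite (_ : hdiag l _ = dgl (fun j => if j == l then unitN1 F ^+ b.-1 * alpha^-1 else 1)%g) ?dglM //.
  by apply: val_inj; congr diag_mx; apply/rowP=> j; rewrite !mxE; case: eqP.
by apply: val_inj; congr diag_mx; apply/rowP=> j; rewrite !mxE; case: eqP.
Qed.

Lemma hvec_perm r k l alpha j : hvec (r k) (r l) alpha (r j) = hvec k l alpha j.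
Proof. by rewrite /hvec !(inj_eq perm_inj). Qed.

Lemma unitF_mulC (x y : {unit F}) : (x * y = y * x)%g.
Proof. by apply: val_inj; rewrite /= mulrC. Qed.

(** At position l the sign on the right meets its own inverse and cancels, so exchanging the
    positions only reparametrises the family. *)
Lemma hvec_swap k l alpha : hvec l k alpha =1 hvec k l (unitN1 F ^+ b.-1 * alpha^-1)%g.
Proof.
move=> j; rewrite /hvec unitF_mulC; congr (_ * _)%g; case: eqP => // _.
by rewrite invMg invgK unitF_mulC mulgKV.
Qed.

Lemma hvec_head k l alpha : k != l -> hvec k l alpha k = alpha.
Proof. by move=> kl; rewrite /hvec eqxx (negbTE kl) mulg1. Qed.

Lemma Xset_sgen i : sgen F i \notin Xset b Fb i.
Proof.
apply/imsetP => -[alpha _]; rewrite hdiag2E => E.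
have : (permGL F (adj i) * dgl (fun=> 1) = permGL F 1 * dgl (hvec (idx0 i) (idx1 i) alpha))%g.
  by rewrite dgl1 mulg1 permGL1 mul1g -E.
case/permGL_dgl_inj => /(congr1 (fun r : 'S_m => r (idx0 i))).
by rewrite /adj tpermL perm1 => /esym/eqP; rewrite (negbTE (idx01 i)).
Qed.

Lemma big_Xset (R : nmodType) i (G : GL -> R) :
  \sum_(d in Xset b Fb i) G d =
  \sum_(alpha in Fb) G (dgl (hvec (idx0 i) (idx1 i) alpha)).
Proof.
rewrite big_imset /=; first by apply: eq_bigr => alpha _; rewrite hdiag2E.
move=> alpha beta _ _; rewrite !hdiag2E => E.
have : (permGL F 1 * dgl (hvec (idx0 i) (idx1 i) alpha) =
        permGL F 1 * dgl (hvec (idx0 i) (idx1 i) beta))%g by rewrite E.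
case/permGL_dgl_inj => _ /(_ (idx0 i)).
by rewrite !hvec_head ?idx01.
Qed.

Hypothesis cardFb : #|Fb| = b.

Lemma hvec_Fb k l alpha j : alpha \in Fb -> hvec k l alpha j \in Fb.
Proof.
by move=> aF; rewrite groupM //; case: eqP => // _; rewrite groupM ?groupV // sign_Fb.
Qed.

Lemma Xset_Hb i : {subset Xset b Fb i <= Hb}.
Proof.
move=> _ /imsetP[alpha aF ->]; rewrite hdiag2E; apply/HbP.
by exists (hvec (idx0 i) (idx1 i) alpha) => // k; apply: hvec_Fb.
Qed.

Lemma XsetJ i d : d \in Xset b Fb i -> (sgen F i * d * sgen F i)%g \in Xset b Fb i.
Proof.
move=> /imsetP[alpha aF ->]; rewrite hdiag2E; apply/imsetP.
exists (unitN1 F ^+ b.-1 * alpha^-1)%g; first by rewrite groupM ?groupV ?sign_Fb.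
rewrite hdiag2E -mulgA sgenE dgl_permGL mulgA -permGLM adjK permGL1 mul1g.
apply: eq_dgl => j /=; rewrite -hvec_swap -(hvec_perm (adj i)) permKV.
by rewrite /adj tpermL tpermR.
Qed.

End Group.

(** * A matrix representation *)

(** The noncommutative skeleton of the braid relation. Here [s] and [t] act on the indices of the
    e's as the transpositions (1 2) and (2 3). The terms with a single e match in pairs, one of them
    through s s = t t; among the terms with two e's, those with one [s] match by the identity for
    e23 e13 and those with one [t] by the identity for e12 e13. *)
Lemma braid_perturb (R : nzRingType) (s t e12 e21 e13 e23 e32 : R) :
  s * t * s = t * s * t -> s * s = t * t ->
  s * e12 = e21 * s -> s * e23 = e13 * s -> s * e13 = e23 * s ->
  t * e23 = e32 * t -> t * e12 = e13 * t -> t * e13 = e12 * t ->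
  e13 * e21 + e12 * e23 = e23 * e13 ->
  e13 * e32 + e23 * e12 = e12 * e13 ->
  e12 * e23 * e12 = e23 * e12 * e23 ->
  (s + e12) * (t + e23) * (s + e12) = (t + e23) * (s + e12) * (t + e23).
Proof.
move=> sts ss s12 s23 s13 t23 t12 t13 q1 q2 q3.
rewrite !(mulrDl, mulrDr) q3 sts.
have -> : s * t * e12 = e23 * s * t by rewrite -mulrA t12 mulrA s13.
have -> : s * e23 * s = e13 * t * t by rewrite s23 -!mulrA ss.
have -> : e12 * t * s = t * s * e23 by rewrite -t13 -!mulrA s23.
have -> : t * e12 * t = e13 * t * t by rewrite t12.
have -> : s * e23 * e12 = e13 * e21 * s by rewrite s23 -mulrA s12 mulrA.
have -> : e12 * t * e12 = e12 * e13 * t by rewrite -mulrA t12 mulrA.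
have -> : t * e12 * e23 = e13 * e32 * t by rewrite t12 -mulrA t23 mulrA.
have -> : e23 * s * e23 = e23 * e13 * s by rewrite -mulrA s23 mulrA.
(* Both sides become sums of the same nine monomials in a different order. *)
rewrite -q1 -q2 !mulrDl !addrA.
by rewrite [LHS](ACl (1*2*5*8*3*7*6*4*9)).
Qed.

(** * Matrices of weighted maps of a finite set *)

Section WeightedMap.
Variables (R : comNzRingType) (X : finType) (N : nat).
Hypothesis cardX : #|X| = N.+1.
Implicit Types (x y : X) (f g : X -> X) (chi psi : X -> R).

Definition pt (i : 'I_N.+1) : X := enum_val (cast_ord (esym cardX) i).
Definition rk x : 'I_N.+1 := cast_ord cardX (enum_rank x).

Lemma ptK : cancel pt rk.
Proof. by move=> i; rewrite /pt /rk enum_valK cast_ordKV. Qed.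
Lemma rkK : cancel rk pt.
Proof. by move=> x; rewrite /pt /rk cast_ordK enum_rankK. Qed.

(** Row x has its only entry in column [f x]: matrices act on row vectors, so a product applies its
    left factor first. *)
Definition wmap f chi : 'M[R]_N.+1 :=
  \matrix_(i, j) (chi (pt i) *+ (pt j == f (pt i))).

Lemma wmap_mul f chi (M : 'M[R]_N.+1) x j :
  (wmap f chi * M) (rk x) j = chi x * M (rk (f x)) j.
Proof.
rewrite mxE (bigD1 (rk (f x))) //= big1 => [|k kx]; rewrite !mxE !rkK ?eqxx ?addr0 //.
by rewrite -(inj_eq (can_inj ptK)) rkK in kx; rewrite (negbTE kx) mul0r.
Qed.

Lemma eq_wmap f g chi psi : f =1 g -> chi =1 psi -> wmap f chi = wmap g psi.
Proof. by move=> fg cp; apply/matrixP=> i j; rewrite !mxE fg cp. Qed.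

Lemma wmap1 : wmap id (fun=> 1) = 1.
Proof.
by apply/matrixP=> i j; rewrite !mxE (inj_eq (can_inj ptK)) eq_sym.
Qed.

Lemma wmapM f g chi psi :
  wmap f chi * wmap g psi = wmap (g \o f) (fun x => chi x * psi (f x)).
Proof.
apply/matrixP=> i j; rewrite -(ptK i) wmap_mul !mxE !rkK /=.
by rewrite mulrnAr.
Qed.

Lemma wmapD f chi psi : wmap f chi + wmap f psi = wmap f (fun x => chi x + psi x).
Proof. by apply/matrixP=> i j; rewrite !mxE mulrnDl. Qed.

End WeightedMap.

(** * The Hecke relations inside a crossed product *)

Section CrossedProduct.
Variables (F : finFieldType) (n b : nat) (Fb : {group {unit F}}).
Local Notation m := n.-1.+1.
Local Notation GL := {'GL_n[F]}.
Variables (R : comNzRingType) (a v : R) (B : algType R).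
Variables (Qm : ('I_m -> F) -> ('S_m -> R) -> B) (Pm : 'S_m -> B).
Implicit Types (r w : 'S_m) (i : 'I_n.-1) (u : seq 'I_n.-1) (c : 'I_m -> F).
Implicit Types (chi : 'S_m -> R) (k l p : 'I_m).

(* Working with these relations only, rather than with the matrices, keeps
   unification from unfolding matrix products. *)
Record crossed_product : Prop := CrossedProduct {
  cp_eq : forall c c' chi chi', c =1 c' -> chi =1 chi' -> Qm c chi = Qm c' chi';
  cp_QM : forall c c' chi chi',
    Qm c chi * Qm c' chi' = Qm (fun k => c k * c' k) (fun w => chi w * chi' w);
  cp_Q1 : Qm (fun=> 1) (fun=> 1) = 1;
  cp_QD : forall c chi chi', Qm c chi + Qm c chi' = Qm c (fun w => chi w + chi' w);
  cp_PM : forall r r', Pm r * Pm r' = Pm (r * r')%g;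
  cp_P1 : Pm 1%g = 1;
  cp_PQ : forall r c chi,
    Pm r * Qm c chi = Qm (c \o r) (fun w => chi (w * r)%g) * Pm r
}.

Hypothesis cp : crossed_product.
Let eq_Qm := cp_eq cp.
Let QmM := cp_QM cp.
Let Qm1 := cp_Q1 cp.
Let QmD := cp_QD cp.
Let PmM := cp_PM cp.
Let Pm1 := cp_P1 cp.
Let Pm_Qm := cp_PQ cp.

Lemma QmC c c' chi chi' : Qm c chi * Qm c' chi' = Qm c' chi' * Qm c chi.
Proof. by rewrite !QmM; apply: eq_Qm => x; rewrite mulrC. Qed.

Definition hF k l (alpha : {unit F}) (j : 'I_m) : F := FinRing.uval (hvec b k l alpha j).

Definition desc k l w : R := (w^-1 l < w^-1 k)%N%g%:R.

Definition Theta k l : B := \sum_(alpha in Fb) Qm (hF k l alpha) (fun=> 1).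
Definition Dm chi : B := Qm (fun=> 1) chi.
(** Indexed by all ordered pairs, not only by simple reflections: conjugation by [Pm] produces pairs
    such as (1,3) or (2,1), which enter the braid relation. *)
Definition Em k l : B := Theta k l * Dm (desc k l).

Lemma Theta_Qm k l c chi : Theta k l * Qm c chi = Qm c chi * Theta k l.
Proof.
by rewrite /Theta mulr_suml mulr_sumr; apply: eq_bigr => alpha _; rewrite QmC.
Qed.

Lemma ThetaC k l k' l' : Theta k l * Theta k' l' = Theta k' l' * Theta k l.
Proof.
by rewrite {2 3}/Theta mulr_suml mulr_sumr; apply: eq_bigr => alpha _; rewrite Theta_Qm.
Qed.

Lemma EmE k l k' l' :
  Em k l * Em k' l' = Theta k l * Theta k' l' * Dm (fun w => desc k l w * desc k' l' w).
Proof.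
rewrite /Em -!mulrA; congr (_ * _); rewrite mulrA -Theta_Qm -mulrA; congr (_ * _).
by rewrite QmM; apply: eq_Qm => x //; rewrite mulr1.
Qed.

Lemma EmE3 k l k' l' p q :
  Em k l * Em k' l' * Em p q = Theta k l * Theta k' l' * Theta p q *
    Dm (fun w => desc k l w * desc k' l' w * desc p q w).
Proof.
rewrite EmE /Em mulrA -[_ * Dm _ * Theta p q]mulrA -Theta_Qm !mulrA -[LHS]mulrA.
by congr (_ * _); rewrite QmM; apply: eq_Qm => x //; rewrite mulr1.
Qed.

Lemma Em_Qm k l c : Em k l * Qm c (fun=> 1) = Qm c (fun=> 1) * Em k l.
Proof. by rewrite /Em -mulrA QmC !mulrA Theta_Qm. Qed.

Lemma EmC k l k' l' : Em k l * Em k' l' = Em k' l' * Em k l.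
Proof. by rewrite !EmE ThetaC; congr (_ * _); apply: eq_Qm => // w; rewrite mulrC. Qed.

Lemma Pm_Em r k l : Pm r * Em k l = Em (r^-1 k)%g (r^-1 l)%g * Pm r.
Proof.
rewrite /Em mulrA -[RHS]mulrA.
have -> : Pm r * Theta k l = Theta (r^-1 k)%g (r^-1 l)%g * Pm r.
  rewrite /Theta mulr_suml mulr_sumr; apply: eq_bigr => alpha _.
  rewrite Pm_Qm; congr (_ * _); apply: eq_Qm => // j /=.
  by rewrite /hF -[in RHS](hvec_perm _ r) !permKV.
rewrite -mulrA Pm_Qm; congr (_ * (_ * _)); apply: eq_Qm => // w.
by rewrite /desc invMg !permM.
Qed.

Hypothesis cardFb : #|Fb| = b.

Lemma Theta_sym k l : Theta k l = Theta l k.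
Proof.
rewrite /Theta [LHS](reindex_inj (h := fun alpha => unitN1 F ^+ b.-1 * alpha^-1)%g).
  apply: eq_big => alpha; first by rewrite groupMl ?groupV ?sign_Fb.
  by move=> _; apply: eq_Qm => // j; rewrite /hF -hvec_swap.
by move=> x y /mulgI /invg_inj.
Qed.

(* The substitution alpha := alpha * beta on the right turns one double sum
   into the other. *)
Lemma Theta_tri k l p : k != l -> k != p -> l != p ->
  Theta k l * Theta l p = Theta k l * Theta k p.
Proof.
move=> kl kp lp; rewrite /Theta !mulr_suml; under eq_bigr do rewrite mulr_sumr.
under [in RHS]eq_bigr do rewrite mulr_sumr.
rewrite exchange_big [RHS]exchange_big /=; apply: eq_bigr => beta bF.
rewrite [LHS](reindex_inj (mulIg beta)); apply: eq_big => alpha.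
  by rewrite groupMr.
move=> _; rewrite !QmM; apply: eq_Qm => // j; rewrite /hF -!FinRing.val_unitM.
congr FinRing.uval; rewrite /hvec.
have [->|jk] := eqVneq j k.
  by rewrite (negbTE kl) (negbTE kp) !mulg1.
have [->|jl] := eqVneq j l.
  by rewrite (negbTE lp) !mulg1 !mul1g (unitF_mulC alpha) invMg mulgA mulgKV.
by rewrite !mulg1 !mul1g.
Qed.

(** Both sides express that p precedes k and l in the order given by w^-1; the left side splits this
    by which of k and l comes first. *)
Lemma desc_split k l p w : k != l -> k != p -> l != p ->
  desc k p w * desc l k w + desc k l w * desc l p w = desc l p w * desc k p w.
Proof.
move=> kl kp lp; rewrite /desc -!natrM -natrD; congr _%:R.
have neq j j' : j != j' -> (w^-1 j)%g != (w^-1 j')%g :> nat.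
  by rewrite (inj_eq val_inj) (inj_eq perm_inj).
by move: (neq _ _ kl) (neq _ _ kp) (neq _ _ lp); do 4?case: ltnP; lia.
Qed.

(** The counterpart with k in the last place, split by the order of l and p. *)
Lemma desc_splitV k l p w : k != l -> k != p -> l != p ->
  desc k p w * desc p l w + desc l p w * desc k l w = desc k l w * desc k p w.
Proof.
move=> kl kp lp; rewrite /desc -!natrM -natrD; congr _%:R.
have neq j j' : j != j' -> (w^-1 j)%g != (w^-1 j')%g :> nat.
  by rewrite (inj_eq val_inj) (inj_eq perm_inj).
by move: (neq _ _ kl) (neq _ _ kp) (neq _ _ lp); do 4?case: ltnP; lia.
Qed.

Lemma desc_swap k l w : k != l -> desc l k w + desc k l w = 1.
Proof.
move=> kl; rewrite /desc -natrD -[1]/(1%:R); congr _%:R.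
have : (w^-1 k)%g != (w^-1 l)%g :> nat by rewrite (inj_eq val_inj) (inj_eq perm_inj).
by case: ltngtP.
Qed.

Lemma desc_idem k l w : desc k l w * desc k l w = desc k l w.
Proof. by rewrite /desc -natrM mulnb andbb. Qed.

(** Together with [Theta_tri] this makes the three products of two of Theta_kl, Theta_kp, Theta_lp
    coincide. *)
Lemma Theta_triV k l p : k != l -> k != p -> l != p ->
  Theta k p * Theta l p = Theta k l * Theta l p.
Proof.
move=> kl kp lp; have pl : p != l by rewrite eq_sym.
by rewrite [RHS]Theta_tri // [RHS]ThetaC -Theta_tri // (Theta_sym p l).
Qed.

(** The two diagonals differ by beta at k and beta^-1 at l, where beta = c_k c_l^-1, and the sum
    over F_b absorbs such a factor. This lets t_d pass the summand with Theta in [rep_comm]. *)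
Lemma Theta_tperm k l (c : 'I_m -> {unit F}) : k != l -> (forall j, c j \in Fb) ->
  Qm (fun j => FinRing.uval (c j)) (fun=> 1) * Theta k l =
  Qm (fun j => FinRing.uval (c (tperm k l j))) (fun=> 1) * Theta k l.
Proof.
move=> kl cF; rewrite /Theta !mulr_sumr.
rewrite [RHS](reindex_inj (mulgI (c k * (c l)^-1)%g)) /=.
apply: eq_big => alpha; first by rewrite groupMl // groupM ?groupV.
move=> _; rewrite !QmM; apply: eq_Qm => // j; rewrite /hF -!FinRing.val_unitM.
congr FinRing.uval; rewrite /hvec.
case: tpermP => [->|->|/eqP jk /eqP jl].
- rewrite eqxx (negbTE kl) !mulg1 mulgA; congr (_ * _)%g.
  by rewrite unitF_mulC mulKVg.
- rewrite eqxx eq_sym (negbTE kl) !mul1g !invMg invgK.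
  rewrite (unitF_mulC (c k)) -!mulgA mulVg mulg1.
  by rewrite unitF_mulC -mulgA.
- by rewrite (negbTE jk) (negbTE jl).
Qed.

Definition gen_img i : B := v *: Pm (adj i) + a *: Em (idx0 i) (idx1 i).
Definition diag_img (d : GL) : B := Qm (fun k => GLval d k k) (fun=> 1).

Lemma diag_img_dgl (c : 'I_m -> {unit F}) : diag_img (dgl c) = Qm (fun k => FinRing.uval (c k)) (fun=> 1).
Proof. by apply: eq_Qm => // k; rewrite dglE eqxx. Qed.

Lemma Pm_adj_Em i k l : Pm (adj i) * Em k l = Em (adj i k) (adj i l) * Pm (adj i).
Proof. by rewrite Pm_Em adjV. Qed.

Lemma rep_comm i : {in Hb n Fb, forall d, diag_img d * gen_img i = gen_img i * diag_img (sgen F i * d * sgen F i)%g}.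
Proof.
move=> _ /HbP[c cF ->].
rewrite -mulgA sgenE dgl_permGL mulgA -permGLM adjK permGL1 mul1g.
rewrite !diag_img_dgl /gen_img mulrDr mulrDl -!scalerAl -!scalerAr Pm_Qm.
congr (_ *: (_ * _) + _ *: _); first by apply: eq_Qm => // k /=; rewrite permK.
rewrite Em_Qm /Em !mulrA; congr (_ * _); rewrite Theta_tperm ?idx01 //; last by move=> j; apply: cF.
by congr (_ * _); apply: eq_Qm => // j; rewrite /= permK.
Qed.

(** With E = Theta D one has E^2 = Theta E, and P E + E P = Theta P because P exchanges ascents and
    descents; hence (vP + aE)^2 = v^2 + a Theta (vP + aE). *)
Lemma rep_quad i : gen_img i ^+ 2 =
  v ^+ 2 *: 1 + a *: (\sum_(d in Xset b Fb i) diag_img d * gen_img i).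
Proof.
have neq := idx01 i.
rewrite -mulr_suml big_Xset -/(Theta _ _).
have -> : \sum_(alpha in Fb) diag_img (dgl (hvec b (idx0 i) (idx1 i) alpha)) =
          Theta (idx0 i) (idx1 i) by apply: eq_bigr => alpha _; rewrite diag_img_dgl.
set k := idx0 i; set l := idx1 i.
have EE : Em k l * Em k l = Theta k l * Em k l.
  rewrite EmE /Em mulrA; congr (_ * _); apply: eq_Qm => // w; exact: desc_idem.
have PE : Pm (adj i) * Em k l + Em k l * Pm (adj i) = Theta k l * Pm (adj i).
  rewrite Pm_adj_Em /adj tpermL tpermR -mulrDl /Em Theta_sym -mulrDr QmD.
  rewrite (_ : Qm _ _ = 1) ?mulr1 // -Qm1; apply: eq_Qm => // w.
  by rewrite desc_swap.
rewrite expr2 {1 2}/gen_img -/k -/l mulrDr !mulrDl -!scalerAl -!scalerAr PmM adjK Pm1 EE.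
rewrite !scalerA -expr2 -addrA; congr (_ + _).
rewrite addrA (mulrC v a) -scalerDr addrC -/k -/l [Em k l * _ + _]addrC PE.
by rewrite /gen_img -/k -/l mulrDr scalerDr -!scalerAr !scalerA addrC.
Qed.

Lemma rep_far i (j : 'I_n.-1) : (i.+1 < j)%N || (j.+1 < i)%N -> gen_img i * gen_img j = gen_img j * gen_img i.
Proof.
move=> far.
have [ij0 ij1] := adj_far far; rewrite orbC in far; have [ji0 ji1] := adj_far far.
have C (x y : R) (M1 M2 : B) :
    M1 * M2 = M2 * M1 -> x *: M1 * (y *: M2) = y *: M2 * (x *: M1).
  by move=> h; rewrite -!scalerAl -!scalerAr !scalerA h mulrC.
rewrite /gen_img !mulrDl !mulrDr addrACA; congr (_ + _ + (_ + _)); apply: C.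
- by rewrite !PmM adj_comm // orbC.
- by rewrite Pm_adj_Em ji0 ji1.
- by rewrite Pm_adj_Em ij0 ij1.
- exact: EmC.
Qed.

Lemma rep_braid i (j : 'I_n.-1) : j = i.+1 :> nat -> gen_img i * gen_img j * gen_img i = gen_img j * gen_img i * gen_img j.
Proof.
move=> ij; have Ej : idx0 j = idx1 i by apply: val_inj; rewrite /= ij.
set k := idx0 i; set l := idx1 i; set p := idx1 j.
have neq (x y : 'I_m) : (x == y) = (x == y :> nat) by [].
have kl : k != l by exact: idx01.
have lp : l != p by rewrite /l -Ej idx01.
have kp : k != p by rewrite neq idx0E idx1E ij; lia.
have ik : adj i k = l by rewrite /adj tpermL.
have il : adj i l = k by rewrite /adj tpermR.
have ip : adj i p = p by rewrite /adj tpermD.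
have jk : adj j k = k by rewrite /adj Ej -/l -/p tpermD // eq_sym.
have jl : adj j l = p by rewrite /adj Ej tpermL.
have jp : adj j p = l by rewrite /adj Ej tpermR.
rewrite /gen_img Ej -/k -/l -/p.
have Z : forall (x y : R) (M1 M2 : B), x *: M1 * (y *: M2) = (x * y) *: (M1 * M2).
  by move=> x y M1 M2; rewrite -scalerAl -scalerAr scalerA.
(* The indices 1, 2, 3 are k, l, p; the three given terms are the images of E_kl and E_lp under the
   two transpositions. *)
apply: (@braid_perturb _ _ _ _ (a *: Em l k) (a *: Em k p) _ (a *: Em p l)).
- rewrite !Z !PmM; congr (_ *: Pm _).
  exact: adj_braid.
- by rewrite !Z !PmM !adjK.
- by rewrite !Z Pm_adj_Em ik il mulrC.
- by rewrite !Z Pm_adj_Em il ip mulrC.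
- by rewrite !Z Pm_adj_Em ik ip mulrC.
- by rewrite !Z Pm_adj_Em jl jp mulrC.
- by rewrite !Z Pm_adj_Em jk jl mulrC.
- by rewrite !Z Pm_adj_Em jk jp mulrC.
- rewrite !Z -scalerDr; congr (_ *: _); rewrite !EmE (Theta_sym l k).
  rewrite [Theta k p * _]ThetaC [Theta l p * _]ThetaC Theta_triV // -Theta_tri // -mulrDr QmD.
  by congr (_ * _); apply: eq_Qm => // w; exact: desc_split.
- rewrite !Z -scalerDr; congr (_ *: _); rewrite !EmE (Theta_sym p l).
  rewrite [Theta l p * Theta k l]ThetaC Theta_triV // -Theta_tri // -mulrDr QmD.
  by congr (_ * _); apply: eq_Qm => // w; exact: desc_splitV.
rewrite !Z; congr (_ *: _); rewrite !EmE3; congr (_ * _).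
  (* Both products of Theta's equal Theta_kl Theta_kp Theta_lp. *)
  rewrite -mulrA [Theta l p * Theta k l]ThetaC -(Theta_triV kl kp lp) mulrA.
  by rewrite -(Theta_tri kl kp lp) (Theta_triV kl kp lp).
apply: eq_Qm => // w.
by rewrite mulrC mulrA desc_idem [RHS]mulrC mulrA desc_idem mulrC.
Qed.

Lemma rep_one : diag_img 1%g = 1.
Proof. by rewrite -(dgl1 F n) diag_img_dgl Qm1. Qed.

Lemma rep_mul : {in Hb n Fb &, forall d d', diag_img d * diag_img d' = diag_img (d * d')%g}.
Proof.
move=> _ _ /HbP[c _ ->] /HbP[c' _ ->]; rewrite dglM !diag_img_dgl QmM.
by apply: eq_Qm => w //; rewrite mulr1.
Qed.

End CrossedProduct.

(** * The module with basis S_n x F^n *)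

Section Representation.
Variables (F : finFieldType) (n b : nat) (Fb : {group {unit F}}).
Local Notation m := n.-1.+1.
Local Notation GL := {'GL_n[F]}.
Local Notation X := ('S_m * {ffun 'I_m -> F})%type.
Variables (R : comNzRingType) (a v : R) (N : nat).
Hypothesis cardX : #|{: X}| = N.+1.
Local Notation B := 'M[R]_N.+1.
Implicit Types (r w : 'S_m) (i : 'I_n.-1) (u : seq 'I_n.-1) (c : 'I_m -> F).
Implicit Types (x : X) (chi : 'S_m -> R) (k l p : 'I_m).

Definition mulX c x : X := (x.1, [ffun k => x.2 k * c k]).
Definition permX r x : X := ((x.1 * r)%g, [ffun k => x.2 (r^-1 k)%g]).

Definition Qm c chi : B := wmap cardX (mulX c) (fun x => chi x.1).
Definition Pm r : B := wmap cardX (permX r) (fun=> 1).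

Lemma eq_Qm c c' chi chi' : c =1 c' -> chi =1 chi' -> Qm c chi = Qm c' chi'.
Proof.
move=> cc hh; apply: eq_wmap => x //; rewrite /mulX; congr pair.
by apply/ffunP=> k; rewrite !ffunE cc.
Qed.

Lemma QmM c c' chi chi' :
  Qm c chi * Qm c' chi' = Qm (fun k => c k * c' k) (fun w => chi w * chi' w).
Proof.
rewrite /Qm wmapM; apply: eq_wmap => x //=; rewrite /mulX /=; congr pair.
by apply/ffunP=> k; rewrite !ffunE mulrA.
Qed.

Lemma Qm1 : Qm (fun=> 1) (fun=> 1) = 1.
Proof.
rewrite -(wmap1 _ cardX); apply: eq_wmap => [[w c]|] //=; rewrite /mulX; congr pair.
by apply/ffunP=> k; rewrite ffunE mulr1.
Qed.

Lemma QmD c chi chi' : Qm c chi + Qm c chi' = Qm c (fun w => chi w + chi' w).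
Proof. exact: wmapD. Qed.

Lemma PmM r r' : Pm r * Pm r' = Pm (r * r')%g.
Proof.
rewrite /Pm wmapM; apply: eq_wmap => x /=; last by rewrite mulr1.
rewrite /permX /= mulgA; congr pair.
by apply/ffunP=> k; rewrite !ffunE invMg permM.
Qed.

Lemma Pm1 : Pm 1%g = 1.
Proof.
rewrite -(wmap1 _ cardX); apply: eq_wmap => [[w c]|] //=; rewrite /permX mulg1; congr pair.
by apply/ffunP=> k; rewrite ffunE invg1 perm1.
Qed.

Lemma Pm_Qm r c chi :
  Pm r * Qm c chi = Qm (c \o r) (fun w => chi (w * r)%g) * Pm r.
Proof.
rewrite /Pm /Qm !wmapM; apply: eq_wmap => x /=; last by rewrite mul1r mulr1.
rewrite /permX /mulX /=; congr pair.
by apply/ffunP=> k; rewrite !ffunE /= permKV.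
Qed.

Lemma Qm_Pm_crossed : crossed_product Qm Pm.
Proof.
split; [exact: eq_Qm | exact: QmM | exact: Qm1 | exact: QmD | exact: PmM | exact: Pm1 | exact: Pm_Qm].
Qed.

Local Notation genm := (gen_img b Fb a v Qm Pm).
Local Notation diagm := (diag_img Qm).

Definition baseX : X := (1%g, [ffun=> 1]).

Lemma Qm_row c chi (M : B) x j :
  (Qm c chi * M) (rk cardX x) j = chi x.1 * M (rk cardX (mulX c x)) j.
Proof. exact: wmap_mul. Qed.

Lemma Pm_row r (M : B) x j : (Pm r * M) (rk cardX x) j = M (rk cardX (permX r x)) j.
Proof. by rewrite wmap_mul mul1r. Qed.

(** Once [Theta] is moved behind the diagonal operator, the descent indicator acts first and is 0 at
    an ascent, which leaves v P_i. *)
Lemma gen_img_row i (M : B) x j : ascent x.1 i ->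
  (genm i * M) (rk cardX x) j = v * M (rk cardX (permX (adj i) x)) j.
Proof.
move=> asc; have E : (Em b Fb Qm (idx0 i) (idx1 i) * M) (rk cardX x) j = 0.
  rewrite /Em (Theta_Qm _ _ Qm_Pm_crossed) -mulrA Qm_row /desc.
  by rewrite ltnNge ltnW ?mul0r.
have Z y (M' : B) (k l : 'I_N.+1) : (y *: M') k l = y * M' k l by rewrite mxE.
by rewrite mulrDl -!scalerAl mxE !Z E mulr0 addr0 Pm_row.
Qed.

Lemma reduced_ascent u i : reduced Fb (rcons u i) -> reduced Fb u /\ ascent (pword u) i.
Proof.
move=> ru; have [ru' _] := reduced_rcons ru; split=> //.
apply: contraT => /inv_desc; move: ru ru'; rewrite !reduced_ninv pword_rcons size_rcons.
by move=> /eqP -> /eqP ->; lia.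
Qed.

Lemma word_row u (M : B) j : reduced Fb u ->
  (\prod_(i <- u) genm i * M) (rk cardX baseX) j =
  v ^+ size u * M (rk cardX (pword u, [ffun=> 1])) j.
Proof.
elim/last_ind: u M => [|u i IHu] M.
  by rewrite !big_nil !mul1r /pword big_nil.
move=> /reduced_ascent[ru asc].
rewrite -cats1 big_cat big_seq1 /= -mulrA IHu // gen_img_row // cats1 size_rcons exprSr mulrA.
congr (_ * M (rk _ _) _); rewrite /permX pword_rcons; congr pair.
by apply/ffunP=> k; rewrite !ffunE.
Qed.

Lemma standard_row u (c : 'I_m -> {unit F}) z : reduced Fb u ->
  (\prod_(i <- u) genm i * diagm (dgl c)) (rk cardX baseX) (rk cardX z) =
  v ^+ size u *+ (z == (pword u, [ffun k => FinRing.uval (c k)])).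
Proof.
move=> ru; rewrite word_row // /diag_img mxE !rkK mulrnAr mulr1; congr (_ *+ (_ == _)).
by rewrite /mulX; congr pair; apply/ffunP=> k; rewrite !ffunE mul1r dglE eqxx.
Qed.

End Representation.


Lemma rep_hecke (F : finFieldType) (n b : nat) (Fb : {group {unit F}}) (N : nat)
    (cardX : #|{: 'S_n.-1.+1 * {ffun 'I_n.-1.+1 -> F}}| = N.+1) :
  #|Fb| = b ->
  hecke_rels b Fb (gen_img b Fb aA vA (Qm (R := Arng) cardX) (Pm Arng cardX)) (diag_img (Qm (R := Arng) cardX)).
Proof.
move=> cardFb; have cp := Qm_Pm_crossed Arng cardX.
split; [ | | move=> i | move=> i j | move=> i j | move=> i].
- exact: (rep_one cp).
- exact: (rep_mul cp).
- exact: (rep_comm b aA vA cp i).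
- exact: (rep_far b Fb aA vA cp).
- exact: (rep_braid aA vA cp cardFb).
- exact: (rep_quad aA vA cp cardFb i).
Qed.

(** * The basis T *)

Lemma right_left_inverse (R : unitRingType) (x y : R) :
  x * y = 1 -> y * x = 1 -> x \is a GRing.unit /\ x^-1 = y.
Proof.
move=> xy yx; have ux : x \is a GRing.unit by apply/unitrP; exists y.
by split=> //; apply: (mulrI ux); rewrite mulrV.
Qed.

Lemma vinvK : vinv * vv = 1.
Proof. by rewrite mulrC vvK. Qed.

Lemma xi_neq0 : av * vinv != 0.
Proof.
apply/eqP => /(congr1 ( *%R^~ vv)); rewrite mul0r -mulrA vinvK mulr1 => /(congr1 val).
move=> /eqP; rewrite /= tofrac_eq0 polyC_eq0 polyX_eq0 //.
Qed.

Section TBasis.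
Variables (F : finFieldType) (n b : nat) (Fb : {group {unit F}}).
Hypothesis cardFb : #|Fb| = b.
Variables (H : algType Arng) (ts : 'I_n.-1 -> H) (td : {'GL_n[F]} -> H).
Hypothesis hH : hecke_presented b Fb ts td.
Variable t : {'GL_n[F]} -> H.
Hypothesis ht : standard_elts Fb ts td t.
Variables (Hv : unitAlgType Av) (iota : {rmorphism H -> Hv}).
Hypothesis hHv : scalar_extension embA iota.

Local Notation GL := {'GL_n[F]}.
Local Notation Hb := (Hb n Fb).
Local Notation WHb := (WHb n Fb).
Local Notation ell := (ell Fb).
Local Notation T := (Telt Fb iota t).
Local Notation X i := (Xset b Fb i).
Local Notation s := (sgen F).
Local Notation xi := (av * vinv).
Implicit Types (x y z d : GL) (i : 'I_n.-1) (u : seq 'I_n.-1).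

Let rels := hH.1.

Lemma iotaZ r h : iota (r *: h) = embA r *: iota h.
Proof. exact: hHv.1. Qed.

(** The functional is one matrix coefficient of the representation, in the row of the base vector
    and the column attached to [x0]. The presentation yields it on H and the universal property of
    the scalar extension carries it to H_v; the power of v in [standard_row] cancels the factor
    v^-l(x) of T_x. *)
Lemma T_dual x0 : x0 \in WHb ->
  exists g : {linear Hv -> Av^o}, {in WHb, forall x, g (T x) = (x == x0)%:R}.
Proof.
move=> /reduced_word[u0 [_ /HbP[c0 _ ->] [ru0 ->]]].
pose X := ('S_n.-1.+1 * {ffun 'I_n.-1.+1 -> F})%type.
(* Matrix rings are formed at successor sizes, so the cardinal, which is positive, is written as a
   successor. *)
have cardX : #|{: X}| = (#|{: X}|.-1).+1.
  by apply/esym/prednK/card_gt0P; exists (1%g, [ffun=> 0]).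
have [f [fs fd] _] := hH.2 _ _ _ (rep_hecke cardX cardFb).
pose z : X := (pword u0, [ffun k => FinRing.uval (c0 k)]).
pose g0 (h : H) : Av^o := embA (f h (rk cardX (baseX F n)) (rk cardX z)).
have g0B : zmod_morphism g0 by move=> h h'; rewrite /g0 raddfB !mxE raddfB.
pose g1 : {additive H -> Av^o} := HB.pack g0 (GRing.isZmodMorphism.Build _ _ g0 g0B).
have g1Z r h : g1 (r *: h) = embA r *: g1 h.
  by rewrite /= /g0 linearZ mxE rmorphM.
have [g gE _] := hHv.2 _ g1 g1Z.
exists g => x /reduced_word[u [_ /HbP[c cF ->] [ru ->]]].
have dH : dgl c \in Hb by apply/HbP; exists c.
rewrite /Telt linearZ gE /= /g0 ht // rmorphM rmorph_prod /= fd //=.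
under eq_bigr do rewrite fs.
rewrite standard_row // ell_mulHb ?word_WHb // (eqP ru) rmorphMn rmorphXn /=.
rewrite -[_ *: _]/(_ * _) mulrnAr -exprMn vinvK expr1n; congr (_%:R).
rewrite !word_pword; congr (nat_of_bool _); apply/eqP/eqP => [[-> /ffunP E]|].
  by congr (_ * _)%g; apply: eq_dgl => k; apply: val_inj; have := E k; rewrite !ffunE.
by case/permGL_dgl_inj => -> E; congr pair; apply/ffunP => k; rewrite !ffunE E.
Qed.

Lemma T_free (gamma gamma' : GL -> Av) :
  \sum_(x in WHb) gamma x *: T x = \sum_(x in WHb) gamma' x *: T x ->
  {in WHb, gamma =1 gamma'}.
Proof.
move=> E x0 x0W; have [g gT] := T_dual x0W.
have coord (de : GL -> Av) : g (\sum_(x in WHb) de x *: T x) = de x0.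
  rewrite linear_sum (bigD1 x0) //= big1 ?addr0 => [|x /andP[xW /negbTE neq]].
    by rewrite linearZ /= gT // eqxx -[_ *: _]/(_ * _) mulr1.
  by rewrite linearZ /= gT // neq scaler0.
by rewrite -(coord gamma) E coord.
Qed.

Lemma t_Hb d : d \in Hb -> t d = td d.
Proof.
move=> dH; have := @ht [::] d; rewrite /word !big_nil mul1g mul1r => -> //.
by rewrite reduced_ninv /pword big_nil ninv1.
Qed.

Lemma ell_Hb d : d \in Hb -> ell d = 0%N.
Proof.
by move=> dH; rewrite -[d]mul1g -(permGL1 F n) ell_inv // ninv1.
Qed.

Lemma T_Hb d : d \in Hb -> T d = iota (td d).
Proof. by move=> dH; rewrite /Telt ell_Hb // t_Hb // expr0 scale1r. Qed.

Lemma T_reduced u d : reduced Fb u -> d \in Hb ->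
  T (word F u * d)%g = vinv ^+ size u *: (\prod_(i <- u) iota (ts i) * iota (td d)).
Proof.
move=> ru dH; rewrite /Telt ht // ell_mulHb ?word_WHb // (eqP ru).
by rewrite rmorphM rmorph_prod.
Qed.

Lemma T1 : T 1%g = 1.
Proof. by rewrite T_Hb ?Hb1 // (rel_one rels) rmorph1. Qed.

Lemma reduced1 i : reduced Fb [:: i].
Proof.
rewrite reduced_ninv /pword big_seq1 -[adj i]mul1g inv_asc ?ninv1 //.
by rewrite /ascent invg1 !perm1.
Qed.

Lemma T_sgen i : T (s i) = vinv *: iota (ts i).
Proof.
have := T_reduced (reduced1 i) (@Hb1 F n Fb); rewrite mulg1 /word !big_seq1 => ->.
by rewrite (rel_one rels) rmorph1 mulr1.
Qed.

Lemma T_mul_Hb x d : x \in WHb -> d \in Hb -> T x * T d = T (x * d)%g.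
Proof.
move=> /reduced_word[u [d' d'H [ru ->]]] dH.
rewrite -mulgA !T_reduced ?HbM // T_Hb // -scalerAl -mulrA -rmorphM.
by rewrite (rel_mul rels).
Qed.

Lemma T_mul_sgen x i : x \in WHb -> ell (x * s i)%g = (ell x).+1 ->
  T x * T (s i) = T (x * s i)%g.
Proof.
move=> /reduced_word[u [d dH [ru ->]]].
have -> : (word F u * d * s i = word F (rcons u i) * (s i * d * s i))%g.
  by rewrite word_rcons -!mulgA (mulgA (s i) (s i)) sgenK mul1g.
rewrite !ell_mulHb ?HbJs ?word_WHb // (eqP ru) => /eqP len.
rewrite !T_reduced ?HbJs ?/reduced ?size_rcons // T_sgen.
rewrite -scalerAl -scalerAr scalerA -exprSr; congr (_ *: _).
rewrite -mulrA -rmorphM (rel_comm rels) // rmorphM mulrA.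
by rewrite -cats1 big_cat big_seq1.
Qed.

Lemma sgen_mul_T x i : x \in WHb -> ell (s i * x)%g = (ell x).+1 ->
  T (s i) * T x = T (s i * x)%g.
Proof.
move=> /reduced_word[u [d dH [ru ->]]].
have -> : (s i * (word F u * d) = word F (i :: u) * d)%g.
  by rewrite /word big_cons mulgA.
rewrite !ell_mulHb ?word_WHb // (eqP ru) => /eqP len.
rewrite !T_reduced ?/reduced // T_sgen -scalerAl -scalerAr scalerA -exprS.
by rewrite big_cons mulrA.
Qed.

Lemma ell_V x : x \in WHb -> ell (x^-1)%g = ell x.
Proof.
move=> /reduced_word[u [d dH [ru ->]]].
rewrite invMg -word_rev ell_mulHb ?word_WHb // (eqP ru).
have -> : (d^-1 * word F (rev u) = word F (rev u) *
    (permGL F (pword (rev u))^-1 * d^-1 * permGL F (pword (rev u))))%g.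
  by rewrite word_pword !mulgA -permGLM mulgV permGL1 mul1g.
rewrite ell_mulHb ?word_WHb ?HbJ ?HbV //.
by have /eqP -> := reduced_rev ru; rewrite size_rev.
Qed.

Definition ThetaT i : Hv := \sum_(d in X i) T d.

Lemma ell_Hb_sgen d i : d \in Hb -> ell (d * s i)%g = 1%N.
Proof.
move=> dH; have -> : (d * s i = s i * (s i * d * s i))%g.
  by rewrite !mulgA sgenK mul1g.
rewrite ell_mulHb ?sgen_WHb ?HbJs //.
by have /eqP := reduced1 i; rewrite /word big_seq1.
Qed.

Lemma ThetaT_sgen i : ThetaT i * T (s i) = T (s i) * ThetaT i.
Proof.
rewrite /ThetaT mulr_suml mulr_sumr.
have K : involutive (fun d => s i * d * s i)%g.
  by move=> d; rewrite -!mulgA sgenK mulg1 mulgA sgenK mul1g.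
rewrite (reindex_inj (inv_inj K)) /=; apply: eq_big => d.
  by apply/idP/idP => /(XsetJ cardFb); rewrite ?K.
move=> /(XsetJ cardFb); rewrite K => dX; have dH := Xset_Hb cardFb dX.
rewrite T_mul_sgen ?T_mul_Hb ?sgen_WHb //.
- by rewrite -!mulgA sgenK mulg1.
- by apply: Hb_WHb; apply: HbJs.
- by rewrite ell_Hb_sgen ?HbJs // ell_Hb ?HbJs.
Qed.

Lemma T_sgen_sqr i : T (s i) * T (s i) = 1 + xi *: (ThetaT i * T (s i)).
Proof.
have iE : iota (ts i) = vv *: T (s i) by rewrite T_sgen scalerA vvK scale1r.
rewrite {1 2}T_sgen -scalerAl -scalerAr scalerA -rmorphM -(expr2 (ts i)) (rel_quad rels).
rewrite rmorphD !iotaZ rmorph1 rmorphXn rmorph_sum scalerDr !scalerA; congr (_ + _).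
  by rewrite -expr2 -exprMn vinvK expr1n scale1r.
rewrite /ThetaT mulr_suml !scaler_sumr; apply: eq_bigr => d dX.
rewrite rmorphM iE -scalerAr scalerA (T_Hb (Xset_Hb cardFb dX)); congr (_ *: _).
by rewrite -/av -!mulrA (mulrC av) (mulrA vinv vv) vinvK mul1r mulrC.
Qed.

Lemma T_sgen_inv i : T (s i) \is a GRing.unit /\ (T (s i))^-1 = T (s i) - xi *: ThetaT i.
Proof.
apply: right_left_inverse.
  by rewrite mulrBr T_sgen_sqr ThetaT_sgen -scalerAr addrK.
by rewrite mulrBl T_sgen_sqr -scalerAl addrK.
Qed.

(** If l(xs) < l(x), then T_x = T_(xs) T_s and the inverse simply cancels; the correction term of
    T_s^-1 survives only in the other case. The indicator merges the two cases, so that all x can be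
    summed at once in [Rb_rec]. *)
Lemma T_mul_sgenV x i : x \in WHb ->
  T x * (T (s i))^-1 =
  T (x * s i)%g - (xi *+ (ell x < ell (x * s i)%g)%N) *: \sum_(d in X i) T (x * d)%g.
Proof.
move=> xW; have [us Vs] := T_sgen_inv i; have [asc|desc] := ell_sgen i xW.
  rewrite Vs mulrBr T_mul_sgen // asc ltnSn mulr1n -scalerAr mulr_sumr.
  by congr (_ - _ *: _); apply: eq_bigr => d /(Xset_Hb cardFb) dH; rewrite T_mul_Hb.
have xs : (x * s i * s i)%g = x by rewrite -mulgA sgenK mulg1.
have -> : (ell x < ell (x * s i)%g)%N = false by lia.
rewrite mulr0n scale0r subr0.
by rewrite -{1}xs -T_mul_sgen ?WHbMs ?xs // mulrK.
Qed.

Lemma T_Hb_inv d : d \in Hb -> T d \is a GRing.unit /\ (T d)^-1 = T (d^-1)%g.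
Proof.
move=> dH; have dV := HbV dH.
by apply: right_left_inverse; rewrite T_mul_Hb ?Hb_WHb // ?mulgV ?mulVg T1.
Qed.

Lemma T_unit x : x \in WHb -> T x \is a GRing.unit.
Proof.
have [k] := ubnP (ell x); elim: k x => // k IHk x lt_k xW.
have [x0|] := posnP (ell x); first by have [] := T_Hb_inv (ell_eq0 xW x0).
move=> /(exists_descent xW)[i Ei].
have xs : (x * s i * s i)%g = x by rewrite -mulgA sgenK mulg1.
rewrite -xs -T_mul_sgen ?xs ?WHbMs // unitrMl; last by have [] := T_sgen_inv i.
by apply: IHk; rewrite ?WHbMs //; lia.
Qed.

(** The definition of [barH] does not state multiplicativity; this is the one instance that the
    recursion uses. Inversion turns ys into s y^-1, so it comes from left multiplication by T_s. *)
Lemma barT_sgen y i : y \in WHb -> ell (y * s i)%g = (ell y).+1 ->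
  (T (y * s i)^-1%g)^-1 = (T y^-1%g)^-1 * (T (s i))^-1.
Proof.
move=> yW asc; have [us _] := T_sgen_inv i.
have E : ell (s i * y^-1)%g = (ell y^-1%g).+1.
  by rewrite -{1}(sgenV F i) -invMg !ell_V ?WHbMs.
by rewrite invMg sgenV -sgen_mul_T ?WHbV // invrM ?T_unit ?WHbV ?sgen_WHb.
Qed.

End TBasis.

(** * The recursion for R* *)

Section BarScalar.
Variable bar : {rmorphism Av -> Av}.
Hypothesis hbar : bar_scalar bar.

Lemma bar_vinv : bar vinv = vv.
Proof.
have : bar vinv * bar vv = 1 by rewrite -rmorphM vinvK rmorph1.
by rewrite hbar.1 => /(congr1 (fun x => x * vv)); rewrite -mulrA vinvK mulr1 mul1r.
Qed.

Lemma bar_xi : bar (av * vinv) = - (av * vinv).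
Proof. by rewrite rmorphM bar_vinv hbar.2 !mulNr expr2 -!mulrA vinvK mulr1. Qed.

(** A ring morphism fixes the integers and the denominators are powers of v, so it is enough to look
    at a, v and v^-1; on a the factors v^-2 and v^2 cancel. *)
Lemma barK : involutive bar.
Proof.
have bar_emb (p : Arng) : bar (bar (embA p)) = embA p.
  have bar_int (k : int) : bar (bar (embA k%:P%:P)) = embA k%:P%:P.
    by rewrite -[k]intz !rmorph_int.
  have bar_a (c : {poly int}) : bar (bar (embA c%:P)) = embA c%:P.
    elim/poly_ind: c => [|c k IHc]; first by rewrite !rmorph0.
    rewrite !rmorphD !rmorphM bar_int /= IHc -/aA -/av; congr (_ * _ + _).
    by rewrite hbar.2 rmorphM rmorphN hbar.2 rmorphXn bar_vinv !mulNr opprK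
               -mulrA -exprMn vinvK expr1n mulr1.
  elim/poly_ind: p => [|p c IHp]; first by rewrite !rmorph0.
  by rewrite !rmorphD !rmorphM bar_a /= IHp -/vA -/vv hbar.1 bar_vinv.
move=> x; have /asboolP[p [k xE]] := Av_valP x.
have -> : x = embA p * vinv ^+ k.
  by apply: val_inj; rewrite rmorphM rmorphXn /= exprVn.
by rewrite !rmorphM !rmorphXn bar_emb bar_vinv hbar.1.
Qed.

End BarScalar.

Lemma forall_ord_recr p (P : pred 'I_p.+1) (Q : pred 'I_p) :
  (forall j, P (widen_ord (leqnSn p) j) = Q j) ->
  [forall j, P j] = [forall j, Q j] && P ord_max.
Proof.
move=> PQ; apply/forallP/andP => [h|[/forallP h hp] j].
  by split=> //; apply/forallP => j; rewrite -PQ.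
have [lt|ge] := ltnP j p; last first.
  by rewrite (_ : j = ord_max) //; apply: val_inj; apply/eqP; rewrite eqn_leq ge -ltnS ltn_ord.
by rewrite (_ : j = widen_ord (leqnSn p) (Ordinal lt)) ?PQ //; apply: val_inj.
Qed.

Section RPolynomials.
Variables (F : finFieldType) (n b : nat) (Fb : {group {unit F}}).
Hypothesis cardFb : #|Fb| = b.
Variables (H : algType Arng) (ts : 'I_n.-1 -> H) (td : {'GL_n[F]} -> H).
Hypothesis hH : hecke_presented b Fb ts td.
Variable t : {'GL_n[F]} -> H.
Hypothesis ht : standard_elts Fb ts td t.
Variables (Hv : unitAlgType Av) (iota : {rmorphism H -> Hv}).
Hypothesis hHv : scalar_extension embA iota.
Variable bar : {rmorphism Av -> Av}.
Hypothesis hbar : bar_scalar bar.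
Variable barH : Hv -> Hv.
Hypothesis hbarH : bar_extends Fb bar (Telt Fb iota t) barH.
Variable Rst : {'GL_n[F]} -> {'GL_n[F]} -> Av.
Hypothesis hR : Rstar_def Fb bar (Telt Fb iota t) barH Rst.

Local Notation GL := {'GL_n[F]}.
Local Notation Hb := (Hb n Fb).
Local Notation WHb := (WHb n Fb).
Local Notation ell := (ell Fb).
Local Notation T := (Telt Fb iota t).
Local Notation X i := (Xset b Fb i).
Local Notation s := (sgen F).
Local Notation xi := (av * vinv).
Implicit Types (x y z d g : GL) (i : 'I_n.-1) (u : seq 'I_n.-1).

(** These conjugates are the actual coefficients of bar T_y; results are proved for them and carried
    back to R* by [barK]. *)
Let Rb x y := bar (Rst x y).

Lemma Rb_expand y : y \in WHb -> \sum_(x in WHb) Rb x y *: T x = (T y^-1%g)^-1.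
Proof.
move=> yW; have delta (V : lmodType Av) (G : GL -> V) :
    \sum_(x in WHb) (x == y)%:R *: G x = G y.
  rewrite (bigD1 y) //= eqxx scale1r big1 ?addr0 // => x /andP[_ /negbTE ->].
  by rewrite scale0r.
(* [bar_extends] speaks only of full sums over W H_b, so T_y is written as one with delta
   coefficients. *)
rewrite -hR // -{1}(delta _ T) hbarH -[RHS](delta _ (fun x => (T x^-1%g)^-1)).
by apply: eq_bigr => x _; rewrite rmorph_nat.
Qed.

Lemma Rb_Hb y x : y \in Hb -> x \in WHb -> Rb x y = (x == y)%:R.
Proof.
move=> yH; have yW := Hb_WHb yH; move: x.
apply: (T_free cardFb hH ht hHv (gamma := Rb^~ y) (gamma' := fun x => (x == y)%:R)).
rewrite Rb_expand // (T_Hb_inv hH ht iota (HbV yH)).2 invgK.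
rewrite (bigD1 y) //= eqxx scale1r big1 ?addr0 // => z /andP[_ /negbTE ->].
by rewrite scale0r.
Qed.

Lemma ell_Hb_mid x d i : x \in WHb -> d \in Hb -> ell (x * d * s i)%g = ell (x * s i)%g.
Proof.
move=> xW dH; have -> : (x * d * s i = x * s i * (s i * d * s i))%g.
  by rewrite -!mulgA (mulgA (s i) (s i)) sgenK mul1g.
by rewrite ell_mulHb ?WHbMs ?HbJs.
Qed.

Lemma Rb_rec y i z : y \in WHb -> ell (y * s i)%g = (ell y).+1 -> z \in WHb ->
  Rb z (y * s i)%g = Rb (z * s i)%g y -
    xi *+ (ell z < ell (z * s i)%g)%N * \sum_(d in X i) Rb (z * d^-1)%g y.
Proof.
move=> yW asc; move: z.
apply: (T_free cardFb hH ht hHv (gamma := Rb^~ (y * s i)%g) (gamma' := fun z => Rb (z * s i)%g y -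
    xi *+ (ell z < ell (z * s i)%g)%N * \sum_(d in X i) Rb (z * d^-1)%g y)).
rewrite Rb_expand ?WHbMs // (barT_sgen cardFb hH ht hHv) // -Rb_expand // mulr_suml.
under eq_bigr => x xW do rewrite -scalerAl (T_mul_sgenV cardFb hH ht hHv) // scalerBr.
under [in RHS]eq_bigr => x xW do rewrite scalerBl.
rewrite !sumrB; congr (_ - _).
  rewrite [RHS](reindex_inj (mulIg (s i))) /=; apply: eq_big => x; first by rewrite WHbMs.
  by rewrite -mulgA sgenK mulg1.
under eq_bigr => x xW do rewrite scalerA scaler_sumr.
under [in RHS]eq_bigr => x xW do rewrite mulr_sumr scaler_suml.
rewrite exchange_big [RHS]exchange_big; apply: eq_bigr => d dX.
have dH := Xset_Hb cardFb dX.
(* Replacing x by xd leaves the indicator unchanged, since l(xd) = l(x) and l(xds) = l(xs). *)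
rewrite [RHS](reindex_inj (mulIg d)) /=; apply: eq_big => x; first by rewrite WHbMd.
by move=> xW; rewrite mulgK (ell_Hb_mid _ xW dH) (ell_mulHb xW dH) mulrC.
Qed.

(** Induction along a descent ys of y. For x != y with l(x) >= l(y), the element xs differs from ys
    and has length at least l(ys), because lengths drop by at most one, while each x d^-1 is longer
    than ys; so all terms of the recursion vanish. *)
Lemma Rb_triangular y : y \in WHb -> Rb y y = 1 /\
  {in WHb, forall x, x != y -> (ell y <= ell x)%N -> Rb x y = 0}.
Proof.
have [k] := ubnP (ell y); elim: k y => // k IHk y lt_k yW.
have [y0|] := posnP (ell y).
  have yH := ell_eq0 yW y0; split=> [|x xW /negbTE neq _]; rewrite Rb_Hb ?eqxx //.
  by rewrite neq.
move=> /(exists_descent yW)[i Ei].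
have ysW : (y * s i)%g \in WHb by rewrite WHbMs.
have yss : (y * s i * s i)%g = y by rewrite -mulgA sgenK mulg1.
have [|IH1 IH0] := IHk (y * s i)%g _ ysW; first by lia.
have rec z : z \in WHb -> Rb z y = Rb (z * s i)%g (y * s i)%g -
    xi *+ (ell z < ell (z * s i)%g)%N * \sum_(d in X i) Rb (z * d^-1)%g (y * s i)%g.
  by move=> zW; rewrite -{1}yss Rb_rec // yss.
split=> [|x xW neq le].
  have -> := rec y yW; rewrite IH1; have -> : (ell y < ell (y * s i)%g)%N = false by lia.
  by rewrite mulr0n mul0r subr0.
rewrite rec // IH0 ?WHbMs //.
- rewrite big1 ?mulr0 ?subr0 // => d /(Xset_Hb cardFb)/HbV dH.
  have E := ell_mulHb xW dH; rewrite IH0 ?WHbMd ?E //; last by lia.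
  by apply/eqP => /(congr1 ell); lia.
- by apply: contraNneq neq => /mulIg ->.
- by have [] := ell_sgen i xW; lia.
Qed.

Lemma Rle_refl y : y \in WHb -> Rle Rst y y.
Proof.
move=> yW; apply/eqP => R0; have [] := Rb_triangular yW.
by rewrite /Rb R0 rmorph0 => /esym/eqP; rewrite oner_eq0.
Qed.

(** If l(xs) > l(x), the recursion for R*_(xd,xs) keeps only the summand that leads back to R*_(x,x)
    = 1, and the value is xi, which is nonzero. Otherwise xd is longer than xs and triangularity
    gives 0. *)
Lemma Rle_Xset x d i : x \in WHb -> d \in X i ->
  Rle Rst (x * d)%g (x * s i)%g = (ell x < ell (x * s i)%g)%N.
Proof.
move=> xW dX; have dH := Xset_Hb cardFb dX; have xdW : (x * d)%g \in WHb by rewrite WHbMd.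
have RE z y : Rst z y = bar (Rb z y) by rewrite /Rb (barK hbar).
have [asc|desc] := ell_sgen i xW.
  rewrite asc ltnSn /Rle RE Rb_rec //.
  have [R1 R0] := Rb_triangular xW.
  have asc' : ell (x * d * s i)%g = (ell x).+1 by rewrite ell_Hb_mid.
  rewrite R0 ?WHbMs //; last by [rewrite asc' leqnSn]; last first.
    by apply/eqP => /(congr1 ell); lia.
  rewrite asc' ell_mulHb // ltnSn (bigD1 d) //= mulgK R1 big1 => [|d' /andP[d'X neq]].
    by rewrite addr0 mulr1 sub0r mulr1n rmorphN (bar_xi hbar) opprK xi_neq0.
  have d'H := HbV (Xset_Hb cardFb d'X).
  rewrite R0 ?WHbMd ?ell_mulHb //; apply: contraNneq neq => E.
  have : (x * (d * d'^-1) = x * 1)%g by rewrite mulgA mulg1.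
  by move/mulgI/(congr1 (mulg^~ d')); rewrite mulgKV mul1g => ->.
have [_ R0] := Rb_triangular (etrans (WHbMs Fb i x) xW).
have Exd := ell_mulHb xW dH.
rewrite /Rle RE R0 ?rmorph0 ?eqxx //.
- by apply/esym/negbTE; lia.
- by apply/eqP => /(congr1 ell); lia.
- by lia.
Qed.

(** The bar involution sends xi to -xi, which turns the minus sign of [Rb_rec] into a plus. *)
Lemma Rst_rec y i z : y \in WHb -> ell (y * s i)%g = (ell y).+1 -> z \in WHb ->
  Rst z (y * s i)%g = Rst (z * s i)%g y +
    xi *+ (ell z < ell (z * s i)%g)%N * \sum_(d in X i) Rst (z * d^-1)%g y.
Proof.
move=> yW asc zW; apply: (inv_inj (barK hbar)).
rewrite [LHS]Rb_rec // rmorphD rmorphM rmorph_sum rmorphMn (bar_xi hbar).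
by rewrite mulNrn mulNr.
Qed.

(** * Sums over distinguished subexpressions *)

Definition distinguished_sum p (sigma : p.-tuple 'I_n.-1) y : Av :=
  \sum_(x in distinguished b Fb Rst sigma | nth 1%g x p == y) xi ^+ nX b Fb sigma x.

(** The condition on one step is named so that the quantifier over steps can be split at its last
    index. *)
Definition good_step p (sigma : p.-tuple 'I_n.-1) (x : p.+1.-tuple GL) (j : 'I_p) : bool :=
  (step x j \in s (tnth sigma j) |: X (tnth sigma j)) &&
  Rle Rst (nth 1%g x j.+1) (nth 1%g x j * s (tnth sigma j))%g.

Lemma in_distinguished p (sigma : p.-tuple 'I_n.-1) (x : p.+1.-tuple GL) :
  (x \in distinguished b Fb Rst sigma) =
  [&& all (mem WHb) x, nth 1%g x 0 == 1%g & [forall j, good_step sigma x j]].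
Proof. by rewrite inE. Qed.

Section Rcons.
Variables (p : nat) (sigma : p.-tuple 'I_n.-1) (i : 'I_n.-1).
Variables (x : p.+1.-tuple GL) (g : GL).
Let sigma' : p.+1.-tuple 'I_n.-1 := [tuple of rcons sigma i].
Let x' : p.+2.-tuple GL := [tuple of rcons x g].
Let e : GL := ((nth 1 x p)^-1 * g)%g.

Lemma nth_rcons_le k : (k <= p)%N -> nth 1%g x' k = nth 1%g x k.
Proof. by move=> kp; rewrite nth_rcons size_tuple ltnS kp. Qed.

Lemma nth_rcons_last : nth 1%g x' p.+1 = g.
Proof. by rewrite nth_rcons size_tuple ltnn eqxx. Qed.

Lemma tnth_rcons_widen (j : 'I_p) : tnth sigma' (widen_ord (leqnSn p) j) = tnth sigma j.
Proof. by rewrite !(tnth_nth i) nth_rcons size_tuple /= ltn_ord. Qed.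

Lemma tnth_rcons_max : tnth sigma' ord_max = i.
Proof. by rewrite (tnth_nth i) nth_rcons size_tuple /= ltnn eqxx. Qed.

Lemma step_rcons_widen (j : 'I_p) : step x' (widen_ord (leqnSn p) j) = step x j.
Proof. by rewrite /step !nth_rcons_le //= ltnW. Qed.

Lemma step_rcons_max : step x' ord_max = e.
Proof. by rewrite /step nth_rcons_last nth_rcons_le. Qed.

Lemma distinguished_rcons :
  (x' \in distinguished b Fb Rst sigma') =
  [&& x \in distinguished b Fb Rst sigma, g \in WHb,
      e \in s i |: X i & Rle Rst g (nth 1%g x p * s i)%g].
Proof.
have good_max : good_step sigma' x' ord_max =
    (e \in s i |: X i) && Rle Rst g (nth 1%g x p * s i)%g.
  rewrite /good_step tnth_rcons_max step_rcons_max; congr (_ && Rle _ _ (_ * _)%g).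
    exact: nth_rcons_last.
  exact: nth_rcons_le.
have good_widen j : good_step sigma' x' (widen_ord (leqnSn p) j) = good_step sigma x j.
  rewrite /good_step tnth_rcons_widen step_rcons_widen.
  congr (_ && Rle _ _ (_ * _)%g); first exact: (@nth_rcons_le j.+1).
  exact: (@nth_rcons_le j (ltnW (ltn_ord j))).
rewrite (in_distinguished sigma' x') (in_distinguished sigma x).
rewrite (forall_ord_recr good_widen) good_max (nth_rcons_le (leq0n p)) all_rcons.
have reorder (b1 b2 b3 b4 b5 : bool) :
    [&& b1 && b2, b3 & b4 && b5] = [&& [&& b2, b3 & b4], b1 & b5].
  by case: b1 b2 b3 b4 => [] [] [] [].
exact: reorder.
Qed.

Lemma nX_rcons : nX b Fb sigma' x' = (nX b Fb sigma x + (e \in X i))%N.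
Proof.
rewrite /nX -!sum1_card !(big_mkcond (fun j => j \in _)) big_ord_recr /=.
rewrite inE tnth_rcons_max step_rcons_max; congr (_ + _)%N.
by apply: eq_bigr => j _; rewrite !inE tnth_rcons_widen step_rcons_widen.
Qed.

End Rcons.

Lemma rcons_tuple_bij p :
  bijective (fun xg : p.+1.-tuple GL * GL => [tuple of rcons xg.1 xg.2]).
Proof.
exists (fun y : p.+2.-tuple GL => ([tuple nth 1%g y k | k < p.+1], nth 1%g y p.+1)).
  case=> x g /=; rewrite nth_rcons_last; congr pair; apply: eq_from_tnth => k.
  have kp : (k <= p)%N by rewrite -ltnS.
  by rewrite tnth_mktuple nth_rcons_le // (tnth_nth 1%g).
move=> y; apply: eq_from_tnth => k; rewrite !(tnth_nth 1%g) /= nth_rcons size_tuple card_ord.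
have [lt|ge] := ltnP k p.+1.
  by rewrite -(tnth_nth 1%g [tuple nth 1%g y k | k < p.+1] (Ordinal lt)) tnth_mktuple.
have kE : k = p.+1 :> nat by apply/eqP; rewrite eqn_leq ge -ltnS ltn_ord.
by rewrite kE eqxx.
Qed.

(** Before a last entry y comes either ys or y d^-1 with d in X_s. The first is always admissible,
    because y <= y; by [Rle_Xset] the second is admissible exactly when l(ys) > l(y), and it
    contributes one more factor xi. *)
Lemma distinguished_sum_rcons p (sigma : p.-tuple 'I_n.-1) i y : y \in WHb ->
  distinguished_sum [tuple of rcons sigma i] y = distinguished_sum sigma (y * s i)%g +
    xi *+ (ell y < ell (y * s i)%g)%N * \sum_(d in X i) distinguished_sum sigma (y * d^-1)%g.
Proof.
move=> yW; rewrite {1}/distinguished_sum (reindex _ (onW_bij _ (rcons_tuple_bij p))) /=.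
pose D (x : p.+1.-tuple GL) := x \in distinguished b Fb Rst sigma.
pose E (x : p.+1.-tuple GL) := ((nth 1 x p)^-1 * y)%g.
(* Only y can be appended to [x]; [E x] is the step this makes, and the boolean multiplicity records
   whether the step is admissible. *)
transitivity (\sum_(x : p.+1.-tuple GL | D x)
    xi ^+ nX b Fb sigma x * (xi ^+ (E x \in X i) *+
      ((E x \in s i |: X i) && Rle Rst y (nth 1 x p * s i)%g))).
  rewrite (eq_bigl (fun xg : p.+1.-tuple GL * GL => D xg.1 && ((xg.2 == y) &&
      ((E xg.1 \in s i |: X i) && Rle Rst y (nth 1 xg.1 p * s i)%g)))); last first.
    case=> x g; rewrite /= distinguished_rcons nth_rcons_last -/(D x).
    move: (D x) => Dx; case: eqVneq => [->|_]; last by rewrite !andbF.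
    by rewrite yW andbT.
  rewrite -(pair_big_dep D (fun (x : p.+1.-tuple GL) g => (g == y) && ((E x \in s i |: X i) &&
      Rle Rst y (nth 1 x p * s i)%g))
    (fun (x : p.+1.-tuple GL) g => xi ^+ nX b Fb [tuple of rcons sigma i] [tuple of rcons x g])) /=.
  apply: eq_bigr => x _; rewrite -/(E x).
  have [ok|ko] := boolP ((E x \in s i |: X i) && Rle Rst y (nth 1 x p * s i)%g); last first.
    by rewrite mulr0n mulr0 big_pred0 // => g; rewrite andbF.
  rewrite mulr1n (eq_bigl (pred1 y)) => [|g]; last by rewrite andbT.
  by rewrite big_pred1_eq nX_rcons exprD.
have sK : (s i)^-1%g = s i by rewrite sgenV.
have distinguished_sumE z : distinguished_sum sigma z = \sum_(x : p.+1.-tuple GL | D x)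
    xi ^+ nX b Fb sigma x * (nth 1%g x p == z)%:R.
  rewrite /distinguished_sum big_mkcondr; apply: eq_bigr => x _.
  by case: ifP; rewrite ?mulr1 ?mulr0.
rewrite distinguished_sumE; under [in RHS]eq_bigr => d _ do rewrite distinguished_sumE.
rewrite exchange_big mulr_sumr -big_split /=; apply: eq_bigr => x _.
rewrite -mulr_sumr mulrCA -mulrDr; congr (_ * _).
have eqE d : (nth 1 x p == y * d^-1)%g = (E x == d).
  apply/eqP/eqP => [E1|<-]; rewrite /E.
    by rewrite E1 invMg invgK -mulgA mulVg mulg1.
  by rewrite invMg invgK mulKVg.
have -> : (nth 1 x p == y * s i)%g = (E x == s i) by rewrite -eqE sK.
rewrite (eq_bigr _ (fun d _ => congr1 (fun c : bool => c%:R : Av) (eqE d))).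
have nth_E : nth 1%g x p = (y * (E x)^-1)%g by rewrite /E invMg invgK mulKVg.
(* As s_i is not in X_i, the two kinds of step do not overlap, and each [x] contributes to at most
   one summand on the right. *)
have [Es|neq] := eqVneq (E x) (s i).
  rewrite in_setU1 Es eqxx orTb (negbTE (Xset_sgen _ _ _)) nth_E Es sK -mulgA sgenK mulg1 Rle_refl //.
  rewrite big1 ?mulr0 ?addr0 // => d dX; case: eqP => // Ed; move: dX.
  by rewrite -Ed (negbTE (Xset_sgen _ _ _)).
rewrite in_setU1 (negbTE neq) add0r.
have [EX|nEX] /= := boolP (E x \in X i); last first.
  rewrite mulr0n big1 ?mulr0 // => d dX; case: eqP => // Ed; move: dX.
  by rewrite -Ed (negbTE nEX).
rewrite (bigD1 (E x)) //= eqxx big1 => [|d /andP[_ /negbTE]]; last by rewrite eq_sym => ->.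
rewrite addr0 mulr1 expr1 nth_E; congr (_ *+ nat_of_bool _).
have dH := HbV (Xset_Hb cardFb EX).
(* Here y is read as (y d^-1) d with d = [E x], the shape that [Rle_Xset] asks for. *)
rewrite -{1}(mulgKV (E x) y) Rle_Xset ?WHbMd //.
by rewrite (ell_Hb_mid i yW dH) (ell_mulHb yW dH).
Qed.

Lemma Rst_distinguished_sum p (sigma : p.-tuple 'I_n.-1) y : reduced Fb sigma -> y \in WHb ->
  Rst y (word F sigma) = distinguished_sum sigma y.
Proof.
elim: p sigma y => [|p IHp] sigma y.
  rewrite tuple0 /= => _ yW; rewrite {1}/word big_nil /distinguished_sum.
  have -> : Rst y 1%g = (y == 1%g)%:R.
    by apply: (inv_inj (barK hbar)); rewrite rmorph_nat -Rb_Hb ?Hb1.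
  have nostep (tau : 0.-tuple 'I_n.-1) (x : 1.-tuple GL) : [forall j, good_step tau x j].
    by apply/forallP; case.
  (* For the empty word the only subexpression is (1), of weight 1, which matches R*_(y,1) =
     delta. *)
  rewrite (eq_bigl (fun x : 1.-tuple GL => (x == [tuple 1%g]) && (y == 1%g))) => [|x]; last first.
    rewrite in_distinguished nostep; case/tupleP: x => x0 v; rewrite (tuple0 v) {v} /=.
    have -> : ([tuple of x0 :: [tuple]] == [tuple 1%g]) = (x0 == 1%g).
      by apply/eqP/eqP => [/(congr1 val) /= []|->]; last exact: val_inj.
    rewrite !andbT; case: (eqVneq x0 1%g) => [->|_]; last by rewrite andbF.
    by rewrite WHb1 /= eq_sym.
  case: eqP => _; last by rewrite big_pred0 // => x; rewrite andbF.
  rewrite (eq_bigl (pred1 [tuple 1%g])) => [|x]; last by rewrite andbT.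
  rewrite big_pred1_eq (_ : nX _ _ _ _ = 0%N) //; apply/eqP.
  by rewrite -leqn0 (leq_trans (max_card _)) // card_ord.
have [tau [i ->]] : exists (tau : p.-tuple 'I_n.-1) i, sigma = [tuple of rcons tau i].
  case: sigma => u; case/lastP: u => [//|u i] su.
  have su' : size u == p by move: su; rewrite size_rcons eqSS.
  by exists (Tuple su'), i; apply: val_inj.
move=> /= rt yW; have [rt' asc] := reduced_rcons rt.
rewrite word_rcons Rst_rec ?word_WHb // distinguished_sum_rcons // IHp ?WHbMs //.
congr (_ + _ * _); apply: eq_bigr => d dX.
by rewrite IHp // WHbMd // HbV // (Xset_Hb cardFb dX).
Qed.

End RPolynomials.

Theorem theorem6p2 (q n a b : nat) (F : finFieldType) (Fb : {group {unit F}})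
    (hq : #|F| = q) (hn : (0 < n)%N) (ha : (0 < a)%N) (hb : (0 < b)%N)
    (hcop : coprime a b) (hab : (a * b = q - 1)%N) (hFb : #|Fb| = b)
    (H : algType Arng) (ts : 'I_n.-1 -> H) (td : {'GL_n[F]} -> H)
    (hH : hecke_presented b Fb ts td)
    (t : {'GL_n[F]} -> H) (ht : standard_elts Fb ts td t)
    (Hv : unitAlgType Av) (iota : {rmorphism H -> Hv})
    (hHv : scalar_extension embA iota)
    (bar : {rmorphism Av -> Av}) (hbar : bar_scalar bar)
    (barH : Hv -> Hv) (hbarH : bar_extends Fb bar (Telt Fb iota t) barH)
    (Rst : {'GL_n[F]} -> {'GL_n[F]} -> Av)
    (hR : Rstar_def Fb bar (Telt Fb iota t) barH Rst)
    (p : nat) (sigma : p.-tuple 'I_n.-1) (hred : reduced Fb sigma)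
    (y : {'GL_n[F]}) (hy : y \in WHb n Fb) (hyw : Rle Rst y (word F sigma)) :
  Rst y (word F sigma) =
    \sum_(x in distinguished b Fb Rst sigma | nth 1%g x p == y)
      (av * vinv) ^+ nX b Fb sigma x.
Proof.
exact: (Rst_distinguished_sum hFb hH ht hHv hbar hbarH hR).
Qed.
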